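(* Suppose that for all $m,n,k,r$ one has \[ \Delta_{h_m} \Theta_{e_k} \nabla E_{n-k, r} = \sum_{\pi \in \mathrm{LD}(m, n \backslash r)^{\bullet k}} q^{\mathrm{dinv}(\pi)} t^{\mathrm{area}(\pi)} x^\pi \] (generalised touching Delta conjecture, valley version). Then for all $m,n,k$ \[ \Delta_{h_m} \Theta_{e_k} \nabla \omega(p_{n-k}) = \sum_{\pi \in \mathrm{LSQ}'(m,n)^{\bullet k}} q^{\mathrm{dinv}(\pi)} t^{\mathrm{area}(\pi)} x^\pi \] (modified generalised Delta square conjecture, valley version). As a special case, if $\Theta_{e_k} \nabla E_{n-k, r} = \sum_{\pi \in \mathrm{LD}(n \backslash r)^{\bullet k}} q^{\mathrm{dinv}(\pi)} t^{\mathrm{area}(\pi)} x^\pi$ holds for all $n,k,r$, then $\Theta_{e_k} \nabla \omega(p_{n-k}) = \sum_{\pi \in \mathrm{LSQ}'(n)^{\bullet k}} q^{\mathrm{dinv}(\pi)} t^{\mathrm{area}(\pi)} x^\pi$.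
   Context: Symmetric functions over $\mathbb{Q}(q,t)$; $\widetilde H_\mu$ are the modified Macdonald polynomials, $M=(1-q)(1-t)$, $B_\mu=\sum_{c\in\mu}q^{a'(c)}t^{l'(c)}$, $T_\mu=\prod_{c\in\mu}q^{a'(c)}t^{l'(c)}$, $\Pi_\mu=\prod_{c\in\mu\setminus(1,1)}(1-q^{a'(c)}t^{l'(c)})$ ($a',l'$ co-arm, co-leg). Operators: $\nabla\widetilde H_\mu=T_\mu\widetilde H_\mu$, $\Delta_f\widetilde H_\mu=f[B_\mu]\widetilde H_\mu$, $\mathbf{\Pi}\widetilde H_\mu=\Pi_\mu\widetilde H_\mu$ ($\Pi_\varnothing=1$), $\Theta_f F=\mathbf{\Pi}\, f[X/M]\,\mathbf{\Pi}^{-1}F$. $E_{n,k}$ is defined by $e_n[X\frac{1-z}{1-q}]=\sum_{k=0}^n\frac{(z;q)_k}{(q;q)_k}E_{n,k}$. $\omega$ is the standard involution, $p_n$ the power sum. Combinatorics: square paths of size $N$ from $(0,0)$ to $(N,N)$ ending east, with shift $s$ (max $s$ with the path meeting $y=x-s$), area word $a_i$ ($i$-th vertical step starts on $y=x+a_i$); partial labellings $w\in\mathbb{N}^N$ with $a_i>a_{i-1}\Rightarrow w_i>w_{i-1}$, $a_1=0\Rightarrow w_1>0$, and some $i$ with $a_i=-s$, $w_i>0$; contractible valleys: $i=1$ and ($a_1<-1$ or $a_1=-1,w_1>0$), or $i>1$ and $a_i<a_{i-1}$, or $i>1$, $a_i=a_{i-1}$, $w_i>w_{i-1}$; $dv$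 a set of $k$ decorated contractible valleys. $\mathrm{area}=\sum_i(a_i+s)$; $\mathrm{dinv}=\#\{\text{inversions }(i,j), j\notin dv\}+\#\{i:a_i<0,w_i>0\}-\#dv$ where $(i<j)$ is an inversion if $a_i=a_j,w_i<w_j$ or $a_i=a_j+1,w_i>w_j$; $x^\pi=\prod x_{w_i}$ with $x_0=1$. $\mathrm{LD}(m,n\backslash r)^{\bullet k}$: such decorated labelled paths with shift $0$ (Dyck paths) of size $m+n$, with $m$ labels $0$, $n$ positive labels, $k$ decorated valleys, and exactly $r$ indices $i\notin dv$ with $a_i=-\mathrm{shift}$ and $w_i>0$. $\mathrm{LSQ}'(m,n)^{\bullet k}$: such square paths of size $m+n$ with $m$ zero labels, $n$ positive labels, $k$ decorated valleys, having at least one $i\notin dv$ with $a_i=-\mathrm{shift}$ and $w_i>0$. Omitted $m$ means $m=0$.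
   Formalization: In dinv the inversions (i,j) counted are those with i not in dv (standard valley convention) instead of j not in dv; with the literal formula the hypothesis already fails at m=0, n=2, k=1, r=1 (q^{-1}e_2 versus e_2). Also 0<=k<n is required so that p_{n-k} makes sense. *)

(* Defs.v *)
From HB Require Import structures.
From mathcomp Require Import all_boot all_order all_algebra.
From mathcomp Require Import finmap.
From mathcomp.multinomials Require Import monalg.

Set Implicit Arguments.
Unset Strict Implicit.
Unset Printing Implicit Defensive.

Import Order.TTheory GRing.Theory Num.Theory.
Local Open Scope ring_scope.

Definition Qqt : fieldType := {fraction {poly {poly rat}}}.
Definition qv : Qqt := tofrac ('X%:P).
Definition tv : Qqt := tofrac 'X.

(* Symmetric functions over Q(q,t) are polynomials in the power sums p_1, p_2,
   ...; the variable of index i stands for p_(i+1). *)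
Definition Sym : comAlgType Qqt := {malg Qqt[{cmonom nat}]}.

(* psum k is p_k; it is only meaningful for k >= 1. *)
Definition psum (k : nat) : Sym := << ucm k.-1 >>.

(* Plethystic evaluation f[A]: the ring morphism extending iota on scalars and
   sending p_k to A k for all k >= 1, where A k = p_k[A]. *)
Definition pleth (S : comNzRingType) (iota : Qqt -> S) (A : nat -> S)
    (f : Sym) : S :=
  mmap iota (fun m : {cmonom nat} => \prod_(i <- finsupp (val m)) A i.+1 ^+ m i) f.

Definition plethSym (A : nat -> Sym) : Sym -> Sym := pleth (in_alg Sym) A.

Definition omega : Sym -> Sym := plethSym (fun k => (-1) ^+ k.-1 * psum k).

(* The sum of z_lambda^-1 p_lambda over the partitions lambda of n, each
   encoded by its multiplicities: m i is the multiplicity of the part i+1. *)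
Definition sym_h (n : nat) : Sym :=
  \sum_(m : {ffun 'I_n -> 'I_n.+1} | (\sum_(i < n) i.+1 * m i)%N == n)
     ((\prod_(i < n) (i.+1 ^ m i * (m i)`!))%N%:R^-1 : Qqt)
       *: \prod_(i < n) psum i.+1 ^+ m i.

Definition sym_e (n : nat) : Sym := omega (sym_h n).

Definition is_partition (mu : seq nat) : bool :=
  sorted geq mu && (0%N \notin mu).

Definition conj_part (mu : seq nat) : seq nat :=
  [seq count (fun p => i < p)%N mu | i <- iota 0 (head 0%N mu)].

(* dominates la mu : la >= mu in dominance order. *)
Definition dominates (la mu : seq nat) : bool :=
  (sumn la == sumn mu) &&
  all (fun i => sumn (take i mu) <= sumn (take i la))%N (iota 0 (sumn mu)).

(* Jacobi-Trudi *)
Definition schur (la : seq nat) : Sym :=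
  \det (\matrix_(i < size la, j < size la)
     (if (i <= nth 0 la i + j)%N then sym_h (nth 0 la i + j - i)%N else 0)).

Definition in_schur_span (P : pred (seq nat)) (f : Sym) : Prop :=
  exists2 r : seq (Qqt * seq nat),
    all (fun x => is_partition x.2 && P x.2) r &
    f = \sum_(x <- r) x.1 *: schur x.2.

(* The cell in row i and column j (from 0) has co-arm j and co-leg i. *)
Definition Bmu (mu : seq nat) (k : nat) : Qqt :=
  \sum_(i < size mu) \sum_(j < nth 0%N mu i) (qv ^+ j * tv ^+ i) ^+ k.

Definition Tmu (mu : seq nat) : Qqt :=
  \prod_(i < size mu) \prod_(j < nth 0%N mu i) (qv ^+ j * tv ^+ i).

Definition Pimu (mu : seq nat) : Qqt :=
  \prod_(i < size mu) \prod_(j < nth 0%N mu i | (i + j != 0)%N)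
     (1 - qv ^+ j * tv ^+ i).

(* The triangularity and normalisation axioms that characterise the family
   of modified Macdonald polynomials. *)
Record modified_macdonald (H : seq nat -> Sym) : Prop := {
  mac_q : forall mu, is_partition mu ->
    in_schur_span (fun la => dominates la mu)
      (plethSym (fun k => (1 - qv ^+ k) *: psum k) (H mu));
  mac_t : forall mu, is_partition mu ->
    in_schur_span (fun la => dominates la (conj_part mu))
      (plethSym (fun k => (1 - tv ^+ k) *: psum k) (H mu));
  mac_1 : forall mu, is_partition mu -> pleth idfun (fun=> 1) (H mu) = 1
}.

(* As (H mu) is a basis of Sym, diag c is determined by this condition. *)
Definition diagonal_in (H : seq nat -> Sym)
    (diag : (seq nat -> Qqt) -> {linear Sym -> Sym}) : Prop :=
  forall c mu, is_partition mu -> diag c (H mu) = c mu *: H mu.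

Section Operators.
Variable diag : (seq nat -> Qqt) -> {linear Sym -> Sym}.

Definition nabla : Sym -> Sym := diag Tmu.

Definition Delta (f : Sym) : Sym -> Sym :=
  diag (fun mu => pleth idfun (Bmu mu) f).

Definition PiOp : Sym -> Sym := diag Pimu.
Definition PiOpV : Sym -> Sym := diag (fun mu => (Pimu mu)^-1).

Definition Theta (f F : Sym) : Sym :=
  PiOp (plethSym (fun k => ((1 - qv ^+ k) * (1 - tv ^+ k))^-1 *: psum k) f
        * PiOpV F).
End Operators.

(* (z;q)_k *)
Definition qpoch (S : comNzRingType) (z q : S) (k : nat) : S :=
  \prod_(i < k) (1 - z * q ^+ i).

(* The identity e_n[X(1-z)/(1-q)] = sum_k (z;q)_k/(q;q)_k E_{n,k}, in which the
   indeterminate z is the variable of {poly Sym}. *)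
Definition is_Enk (E : nat -> nat -> Sym) : Prop :=
  forall n : nat,
    pleth (fun c : Qqt => (c%:A : Sym)%:P)
          (fun k => ((1 - qv ^+ k)^-1 *: psum k)%:P * (1 - 'X^k)) (sym_e n)
    = \sum_(k < n.+1)
        qpoch 'X ((qv%:A : Sym)%:P) k * ((qpoch qv qv k)^-1 *: E n k)%:P.

(* A lattice path is the sequence of its steps: true = north, false = east. *)
Definition square_path (N : nat) (p : seq bool) : bool :=
  [&& size p == (N + N)%N, count id p == N & ~~ last true p].

(* The area word, d being y - x at the starting point. *)
Fixpoint area_word (d : int) (p : seq bool) : seq int :=
  match p with
  | [::] => [::]
  | true :: p' => d :: area_word (d + 1) p'
  | false :: p' => area_word (d - 1) p'
  end.

(* The largest x - y over the points (x, y) of the path (truncated subtraction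
   is harmless, since the path starts at (0, 0)). *)
Definition shift (p : seq bool) : nat :=
  (\max_(j < (size p).+1) (count negb (take j p) - count id (take j p)))%N.

(* Steps, labels and decorations. Labels are at most l: only x_1, ..., x_l are
   kept, the other variables being set to 0. *)
Definition dlpath (N l : nat) : finType :=
  ((N + N).-tuple bool * N.-tuple 'I_l.+1 * {set 'I_N})%type.

Section Paths.
Variables (N l : nat) (P : dlpath N l).

Definition steps : seq bool := P.1.1.
Definition height (i : nat) : int := nth 0 (area_word 0 steps) i.
Definition label (i : nat) : nat := nth 0%N (map val P.1.2) i.
Definition dv : {set 'I_N} := P.2.
Definition pshift : nat := shift steps.

Definition partial_labelling : bool :=
  [&& [forall i : 'I_N, (0 < i)%N && (height i > height i.-1) ==>
        (label i > label i.-1)%N],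
      [forall i : 'I_N, ((i : nat) == 0%N) && (height i == 0) ==> (label i > 0)%N]
    & [exists i : 'I_N, (height i == - pshift%:Z) && (label i > 0)%N]].

Definition contractible_valley (i : 'I_N) : bool :=
  if (i : nat) == 0%N then (height i < -1) || (height i == -1) && (label i > 0)%N
  else (height i < height i.-1) ||
       (height i == height i.-1) && (label i > label i.-1)%N.

Definition inversion (i j : 'I_N) : bool :=
  (i < j)%N && ((height i == height j) && (label i < label j)%N
                || (height i == height j + 1) && (label i > label j)%N).

(* A decoration kills the inversions of which its valley is the left end i, not
   the right end j. For instance the path NENE with labels 1, 2 and its second
   north step decorated keeps its inversion, which offsets the term - #|dv|, and has
   dinv 0. *)
Definition dinv : int :=
  #|[set ij : 'I_N * 'I_N | inversion ij.1 ij.2 && (ij.1 \notin dv)]|%:Z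
  + #|[set i : 'I_N | (height i < 0) && (label i > 0)%N]|%:Z - #|dv|%:Z.

Definition area : int := \sum_(i < N) (height i + pshift%:Z).

Definition monomial : {malg Qqt['X_{1..l}]} :=
  \prod_(i < N) (if unlift ord0 (tnth P.1.2 i) is Some j then << ucm j >> else 1).

Definition weight : {malg Qqt['X_{1..l}]} :=
  (qv ^ dinv * tv ^ area) *: monomial.

Definition touching : nat :=
  #|[set i : 'I_N | [&& i \notin dv, height i == - pshift%:Z & (label i > 0)%N]]|.

Definition decorated_square_path (m n k : nat) : bool :=
  [&& square_path N steps, partial_labelling,
      #|[set i : 'I_N | label i == 0%N]| == m,
      #|[set i : 'I_N | (label i > 0)%N]| == n,
      dv \subset [set i | contractible_valley i] & #|dv| == k].

Definition in_LD (m n r k : nat) : bool :=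
  [&& decorated_square_path m n k, pshift == 0%N & touching == r].

Definition in_LSQ' (m n k : nat) : bool :=
  decorated_square_path m n k && (0 < touching)%N.
End Paths.

(* f(x_1, ..., x_l) *)
Definition in_vars (l : nat) (f : Sym) : {malg Qqt['X_{1..l}]} :=
  pleth (in_alg {malg Qqt['X_{1..l}]})
        (fun k => \sum_(i < l) << ucm i >> ^+ k) f.

Definition LD_sum (m n r k l : nat) : {malg Qqt['X_{1..l}]} :=
  \sum_(P : dlpath (m + n) l | in_LD P m n r k) weight P.

Definition LSQ'_sum (m n k l : nat) : {malg Qqt['X_{1..l}]} :=
  \sum_(P : dlpath (m + n) l | in_LSQ' P m n k) weight P.

(* A symmetric function equals a formal power series in x_1, x_2, ... iff they
   agree after the restriction to finitely many variables. *)
Definition is_gf (f : Sym) (S : forall l : nat, {malg Qqt['X_{1..l}]}) : Prop :=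
  forall l : nat, in_vars l f = S l.

(* Main.v *)
From HB Require Import structures.
From mathcomp Require Import all_boot all_order all_algebra.
From mathcomp Require Import finmap.
From mathcomp.multinomials Require Import monalg.
From mathcomp Require Import ring zify.
Require Import Defs.

Set Implicit Arguments.
Unset Strict Implicit.
Unset Printing Implicit Defensive.

Import Order.TTheory GRing.Theory Num.Theory.
Local Open Scope ring_scope.

(* A square path of shift j is read as a word of letters (level, label,
   decorated), the level being the height plus j + 1.  For a fixed multiset C of
   letters and every j, let G_j(C) be the sum of q^dinv over the words with
   content C that come from square paths of shift j; G_0 is the Dyck case.

   G_j is computed by inserting letters one at a time: the admissible positions
   for a new letter come with consecutive dinv increments, so each insertion
   multiplies G_j by a difference of two powers of q.  For j > 0 the undecorated
   letters of level <= j have to be inserted downwards and the others upwards.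
   Comparing the products for j and j + 1, which differ only on two adjacent
   diagonals, amounts to a telescoping product along a walk.  Writing u_h and z_h
   for the numbers of undecorated positive letters and of decorated zeros of
   level h, and d_h = u_h - z_(h-1), one gets
     (1 - q^d_1) G_j(C) = q^(d_1 + ... + d_j) (1 - q^d_(j+1)) G_0(C),
   so that sum_j G_j(C) = [n-k]_q / [r]_q G_0(C), where d_1 = u_1 = r is the number
   of touching points.  Together with
     omega(p_N) = sum_(r >= 1) [N]_q / [r]_q E_(N,r)
   this gives the theorem, as the operators involved are linear: nothing about
   Macdonald polynomials is needed. *)

(** * Words and insertion of a letter *)

Fixpoint splits (T : Type) (w : seq T) : seq (seq T * seq T) :=
  ([::], w) :: if w is x :: w' then [seq (x :: p.1, p.2) | p <- splits w'] else [::].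

Section Splits.
Variable T : eqType.
Implicit Types (w s : seq T) (p : seq T * seq T).

Lemma mem_splits w p : (p \in splits w) = (p.1 ++ p.2 == w).
Proof.
elim: w p => [|x w IH] [u v] /=; first by case: u; case: v.
rewrite inE xpair_eqE; case: u => [|z u] /=.
  by case: eqP => //= _; apply/negbTE/mapP => -[].
rewrite eqseq_cons; apply/mapP/andP => [[[u' v'] + [-> -> ->]]|[/eqP-> Ew]].
  by rewrite IH.
by exists (u, v) => //; rewrite IH.
Qed.

Lemma splits_uniq w : uniq (splits w).
Proof.
elim: w => //= x w IH; rewrite map_inj_uniq ?IH ?andbT; last by move=> [? ?] [? ?] [-> ->].
by apply/mapP => -[].
Qed.

(** A split whose right part starts with [y] stands for a marked copy of [y] in [w]; dropping this
    copy leaves the two words around the mark. *)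
Lemma mem_splits_head w y p :
  (p \in [seq (p.1, behead p.2) | p <- splits w & ohead p.2 == Some y])
  = (p.1 ++ y :: p.2 == w).
Proof.
case: p => u v; apply/mapP/eqP => /= [[[u' [|z v']]]|<-].
- by rewrite mem_filter.
- by rewrite mem_filter mem_splits => /= /andP[/eqP [->] /eqP <-] [-> ->].
- by exists (u, y :: v); rewrite // mem_filter mem_splits /= !eqxx.
Qed.

Lemma uniq_splits_head w y :
  uniq [seq (p.1, behead p.2) | p <- splits w & ohead p.2 == Some y].
Proof.
rewrite map_inj_in_uniq ?filter_uniq ?splits_uniq //.
move=> [u [|x v]] [u' [|x' v']]; rewrite ?mem_filter //= => /andP[/eqP [->] _].
by move=> /andP[/eqP [->] _] [-> ->].
Qed.

Lemma allpairs_uniq_inv (S U : eqType) (r1 : seq S) (r2 : S -> seq U) (g : U -> S) :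
  uniq r1 -> (forall x, uniq (r2 x)) -> (forall x u, u \in r2 x -> g u = x) ->
  uniq [seq u | x <- r1, u <- r2 x].
Proof.
move=> U1 U2 gP; apply: allpairs_uniq_dep => // a b.
move=> /allpairsPdep[x [u [_ ux ->]]] /allpairsPdep[x' [u' [_ ux' ->]]] /= e.
by move: ux'; rewrite -e => /gP; rewrite (gP _ _ ux) => ->.
Qed.

(** Both sides enumerate, each once, the pairs [(u, v)] with [u ++ v] a rearrangement of [s]:
    erasing the marked [y] opens a gap, and filling the gap with a marked [y] undoes this. *)
Lemma sum_marked_permutations (R : nmodType) (y : T) s (F : seq T * seq T -> R) :
  \sum_(w <- permutations (y :: s))
     \sum_(p <- splits w | ohead p.2 == Some y) F (p.1, behead p.2)
  = \sum_(w <- permutations s) \sum_(p <- splits w) F p.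
Proof.
have E w : \sum_(p <- splits w | ohead p.2 == Some y) F (p.1, behead p.2) =
  \sum_(p <- [seq (p.1, behead p.2) | p <- splits w & ohead p.2 == Some y]) F p.
  by rewrite big_map big_filter.
under eq_bigr do rewrite E.
have EL r1 (r2 : seq T -> seq (seq T * seq T)) : \sum_(w <- r1) \sum_(p <- r2 w) F p =
  \sum_(p <- [seq p | w <- r1, p <- r2 w]) F p by rewrite big_allpairs_dep.
rewrite !EL.
apply: perm_big; apply: uniq_perm.
- apply: (@allpairs_uniq_inv _ _ _ _ (fun p => p.1 ++ y :: p.2)); rewrite ?permutations_uniq //.
    by move=> w; exact: uniq_splits_head.
  by move=> w p; rewrite mem_splits_head => /eqP.
- apply: (@allpairs_uniq_inv _ _ _ _ (fun p => p.1 ++ p.2)); rewrite ?permutations_uniq //.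
    by move=> w; exact: splits_uniq.
  by move=> w p; rewrite mem_splits => /eqP.
have insE u v : perm_eq (u ++ y :: v) (y :: s) = perm_eq (u ++ v) s.
  by rewrite (perm_catCA u [:: y] v) perm_cons.
move=> p; apply/allpairsPdep/allpairsPdep => -[w [p' []]]; rewrite mem_permutations.
  move=> pw; rewrite mem_splits_head => /eqP Ew ->; exists (p'.1 ++ p'.2), p'.
  by rewrite mem_permutations mem_splits eqxx -insE Ew.
move=> pw; rewrite mem_splits => /eqP Ew ->; exists (p'.1 ++ y :: p'.2), p'.
by rewrite mem_permutations mem_splits_head eqxx insE Ew.
Qed.

(** Successive copies of [y] see 0, 1, 2, ... copies on their left. For [f i = q ^+ i] and [a = 0]
    the sum is a q-integer; the offset [a] serves the induction. *)
Lemma sum_marks_left (R : nmodType) (f : nat -> R) (y : T) w (a : nat) :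
  \sum_(p <- splits w | ohead p.2 == Some y) f (a + count_mem y p.1)%N
  = \sum_(a <= i < a + count_mem y w) f i.
Proof.
elim: w a => [|x w IH] a /=.
  by rewrite big_cons big_nil /= addn0 big_geq.
rewrite big_cons big_map /= addn0.
under eq_bigr do rewrite addnA.
rewrite IH (inj_eq (@Some_inj _)); case: eqVneq => _ /=; last by rewrite addn0.
by rewrite addnA addn1 [RHS]big_ltn //; lia.
Qed.

Lemma sum_marks_right (R : nmodType) (f : nat -> R) (y : T) w :
  \sum_(p <- splits w | ohead p.2 == Some y) f (count_mem y (behead p.2))
  = \sum_(0 <= i < count_mem y w) f i.
Proof.
elim: w => [|x w IH] /=; first by rewrite big_cons big_nil big_geq.
rewrite big_cons big_map /= IH.
rewrite (inj_eq (@Some_inj _)); case: eqVneq => _ //=.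
by rewrite add1n big_nat_recr //= addrC.
Qed.
End Splits.

Definition letter : eqType := (nat * nat * bool)%type.
Definition lev (x : letter) : nat := x.1.1.
Definition lab (x : letter) : nat := x.1.2.
Definition dec (x : letter) : bool := x.2.

(* Whether u may follow p: a rise needs increasing labels and is not decorated, and
   a decorated u has to be a contractible valley. *)
Definition step (p u : letter) : bool :=
  [|| (lev u < lev p)%N,
      (lev u == lev p) && (dec u ==> (lab p < lab u)%N)
    | [&& lev u == (lev p).+1, (lab p < lab u)%N & ~~ dec u]].

(* A virtual letter before the word: with it, the rules for the first step of a
   square path of shift j become instances of step. *)
Definition start (j : nat) : letter := (j, 0%N, false).

(** A square path ends east exactly when its last north step starts at height at least 0, that is,
    at a level above [j]. The default [start j.+1] makes the empty word valid. *)
Definition valid (j : nat) (w : seq letter) : bool :=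
  path step (start j) w && (j < lev (last (start j.+1) w))%N.

Definition attacks (x y : letter) : bool :=
  (lev x == lev y) && (lab x < lab y)%N || (lev x == (lev y).+1) && (lab y < lab x)%N.

(* dinv without the terms depending only on the content of w. *)
Fixpoint word_inv (w : seq letter) : nat :=
  if w is x :: w' then ((if dec x then 0 else count (attacks x) w') + word_inv w')%N else 0%N.

Lemma word_inv_insert w1 y w2 :
  word_inv (w1 ++ y :: w2) =
  (count (fun x => ~~ dec x && attacks x y) w1 + (if dec y then 0 else count (attacks y) w2)
   + word_inv (w1 ++ w2))%N.
Proof.
elim: w1 => [|x w1 IH] /=; first by rewrite add0n.
by rewrite IH !count_cat /=; case: (dec x) => /=; lia.
Qed.

(* Around y the letters fall into four classes: act (y fits on both sides), cp
   (copies of a decorated y: neither side), those that y may only follow, and those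
   that y may only precede.  By stepP a letter of the last class is never directly
   followed by one of the third, nor by a copy, so there is exactly one gap for y, or
   one copy filling it, between consecutive act letters. *)
Section Gaps.
Variables (R : nmodType) (y st : letter) (s : seq letter) (act cp : pred letter) (e : bool).
Hypothesis actP : forall x, x \in s -> act x -> step x y && step y x.
Hypothesis cpP : forall x, x \in s -> cp x -> ~~ step x y && ~~ step y x.
Hypothesis otherP : forall x, x \in s -> ~~ act x -> ~~ cp x -> step x y = ~~ step y x.
Hypothesis stepP : forall p x, p \in st :: s -> x \in s -> step p x -> step p y || step y x.

Definition gap (p : letter) (r : seq letter * seq letter) : bool :=
  step (last p r.1) y && (if r.2 is u :: _ then step y u else e).

(** The argument of [f] rises by one at an [act] letter and falls by one at a copy. As one gap or
    one copy lies between consecutive [act] letters, it rises by exactly one from each gap to the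
    next. The inequality is carried along because over a reversed range the sum is empty, while a
    difference of powers of [q] need not vanish. *)
Lemma sum_gaps_from (f : nat -> R) w p a :
  p \in st :: s -> {subset w <= s} -> path step p w -> (~~ e -> step (last p w) y) ->
  (count cp w + ~~ step p y <= count act w + e)%N /\
  \sum_(r <- splits w | gap p r) f (a + count act r.1 + count cp r.2)%N
  = \sum_(a + count cp w + ~~ step p y <= i < a + count act w + e) f i.
Proof.
elim: w p a => [|x w IH] p a ps ws /=.
  move=> _; rewrite big_cons big_nil /gap /= !addn0.
  case: e; case: (step p y) => //= H; split=> //; rewrite ?addn0 ?addn1.
  - by rewrite big_nat1 addr0.
  - by rewrite big_geq.
  - by rewrite big_geq.
  - by have := H isT.
  - by have := H isT.
move=> /andP[px xw] elast; rewrite big_cons /= big_map.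
have xs : x \in s by apply: ws; rewrite mem_head.
have [||//|//|/=] := IH x (a + act x)%N.
- by rewrite inE xs orbT.
- by move=> z zw; apply: ws; rewrite inE zw orbT.
move=> le_w sum_w.
have -> : \sum_(r <- splits w | gap p (x :: r.1, r.2))
    f (a + (act x + count act r.1) + count cp r.2)%N =
  \sum_(a + act x + count cp w + ~~ step x y <= i < a + act x + count act w + e) f i.
  by rewrite -sum_w; apply: eq_bigr => r _; rewrite addnA.
rewrite {1}/gap /= addn0.
have acx := actP xs; have cpx := cpP xs; have ox := otherP xs.
have st4 := stepP ps xs px.
case Ea: (act x) acx ox => acx ox.
  have /andP[Pxy Pyx] := acx isT; have Ncp : cp x = false by apply/negP => /cpx; rewrite Pxy.
  rewrite Pxy Pyx Ncp /= in le_w sum_w *.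
  case: (step p y) => /=; split; try by move: le_w; clear; lia.
    rewrite [RHS]big_ltn; last by move: le_w; clear; lia.
    by congr (f _ + \big[_/_]_(_ <= i < _) _); clear; lia.
  by congr (\big[_/_]_(_ <= i < _) _); clear; lia.
case Ec: (cp x) cpx ox => cpx ox.
  have /andP[/negbTE Pxy /negbTE Pyx] := cpx isT.
  rewrite Pxy Pyx /= orbF in st4 le_w sum_w *; rewrite st4 /=; split; first by move: le_w; clear; lia.
  by congr (\big[_/_]_(_ <= i < _) _); clear; lia.
have := ox isT isT; case: (step y x) st4 le_w => /= st4 le_w; move=> ox'; rewrite ox' /= in le_w sum_w *.
  case: (step p y) => /=; split; try by move: le_w; clear; lia.
    rewrite [RHS]big_ltn; last by move: le_w; clear; lia.
    by congr (f _ + \big[_/_]_(_ <= i < _) _); clear; lia.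
  by congr (\big[_/_]_(_ <= i < _) _); clear; lia.
rewrite orbF in st4; rewrite st4 /=; split; first by move: le_w; clear; lia.
by congr (\big[_/_]_(_ <= i < _) _); clear; lia.
Qed.
End Gaps.

Lemma geometric_sum (R : comNzRingType) (q : R) (m n : nat) : (m <= n)%N ->
  (1 - q) * (\sum_(m <= i < n) q ^+ i) = q ^+ m - q ^+ n.
Proof.
move=> mn; rewrite mulr_sumr (eq_bigr (fun i => - (q ^+ i.+1 - q ^+ i))) => [|i _].
  by rewrite sumrN telescope_sumr // opprB.
by rewrite exprS mulrBl mul1r opprB.
Qed.

(** * Effect of inserting one letter on the generating function *)

Section Insertion.
Variables (R : comNzRingType) (q : R).

Definition words_gf (j : nat) (s : seq letter) : R :=
  \sum_(w <- permutations s | valid j w) q ^+ word_inv w.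

Lemma eq_words_gf j s s' : perm_eq s s' -> words_gf j s = words_gf j s'.
Proof. by move=> ss'; apply: perm_big; apply: perm_permutations. Qed.

Variables (j : nat) (y : letter) (s : seq letter) (act cp : pred letter).
Hypothesis actP : forall x, x \in s -> act x -> step x y && step y x.
Hypothesis cpP : forall x, x \in s -> cp x -> ~~ step x y && ~~ step y x.
Hypothesis otherP : forall x, x \in s -> ~~ act x -> ~~ cp x -> step x y = ~~ step y x.
Hypothesis stepP : forall p x, p \in start j :: s -> x \in s ->
  step p x -> step p y || step y x.
Hypothesis step_trans : forall p x, p \in start j :: s -> x \in s ->
  step p y -> step y x -> step p x.
Hypothesis step_end : forall p, p \in s -> step p y -> (j < lev y)%N -> (j < lev p)%N.
Hypothesis step_start : [|| s != [::], (j < lev y)%N | step (start j) y].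

(** By [step_trans] and [step_end], taking [y] out of a valid word leaves a valid word; so the valid
    words with a marked [y] are the valid words of content [s] with an admissible gap filled. *)
Lemma valid_insert w1 w2 : perm_eq (w1 ++ w2) s ->
  valid j (w1 ++ y :: w2) =
  valid j (w1 ++ w2) && gap y (j < lev y)%N (start j) (w1, w2).
Proof.
move=> p12; have ms x : x \in w1 ++ w2 -> x \in s by rewrite (perm_mem p12).
have lastP : last (start j) w1 \in start j :: s.
  by have := mem_last (start j) w1; rewrite !inE => /orP[-> //|H]; rewrite ms ?orbT // mem_cat H.
rewrite /valid /gap /= !cat_path !last_cat /= -!andbA.
case: w2 p12 ms => [|u w2] p12 ms /=.
  case P1: (path _ _ _) => //=.
  have -> : last (start j.+1) w1 = if w1 == [::] then start j.+1 else last (start j) w1 by case: (w1).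
  case: eqP => [->|/eqP w1n] /=; first by rewrite /start /lev /= ltnSn.
  case sy: (step _ y); rewrite /= ?andbF //; case jy: (j < lev y)%N; rewrite ?andbF //=.
  rewrite andbT; apply/esym/(step_end _ sy jy)/ms.
  by case: (w1) w1n => //= a b _; rewrite cats0 mem_last.
case P1: (path _ _ _) => //=; rewrite -!andbA.
case sy: (step _ y); rewrite /= ?andbF //; case su: (step y u); rewrite /= ?andbF ?andbT //.
by rewrite (step_trans lastP _ sy su) // ms // mem_cat mem_head orbT.
Qed.

Definition gap_start : nat := (count cp s + ~~ step (start j) y)%N.
Definition gap_end : nat := (count act s + (j < lev y))%N.

Lemma valid_endP w : perm_eq w s -> valid j w ->
  ~~ (j < lev y)%N -> step (last (start j) w) y.
Proof.
move=> ws /andP[_ wl] jy; case: w wl ws => [_|a w] /=.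
  by rewrite perm_sym => /perm_nilP s0; move: step_start; rewrite s0 (negbTE jy).
by move=> jl _; rewrite /step; apply/orP; left; lia.
Qed.

Lemma gap_start_le_end w : perm_eq w s -> valid j w -> (gap_start <= gap_end)%N.
Proof.
(* Only the inequality of [sum_gaps_from] is wanted here, hence the zero weight. *)
move=> ws vw; have [||||/= + _] := @sum_gaps_from R y (start j) s act cp (j < lev y)%N actP cpP otherP
  stepP (fun=> 0) w (start j) 0%N; rewrite ?mem_head //.
- by move=> x; rewrite (perm_mem ws).
- by case/andP: vw.
- exact: valid_endP.
by rewrite /gap_start /gap_end -!(permP ws).
Qed.

Variables (left_marks : bool) (f : nat -> R).
Hypothesis weightP : forall w1 w2, perm_eq (w1 ++ w2) s ->
  q ^+ (word_inv (w1 ++ y :: w2) + count_mem y (if left_marks then w1 else w2)) =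
  f (count act w1 + count cp w2) * q ^+ word_inv (w1 ++ w2).

(* Double counting of the words with content y :: s and a marked copy of y, the
   mark being weighted by the number of copies on one side of it. *)
Theorem words_gf_insert :
  (\sum_(0 <= i < count_mem y (y :: s)) q ^+ i) * words_gf j (y :: s)
  = (\sum_(gap_start <= i < gap_end) f i) * words_gf j s.
Proof.
pose F (p : seq letter * seq letter) : R :=
  if valid j (p.1 ++ y :: p.2) then
    q ^+ (word_inv (p.1 ++ y :: p.2) + count_mem y (if left_marks then p.1 else p.2)) else 0.
transitivity (\sum_(w <- permutations (y :: s))
  \sum_(p <- splits w | ohead p.2 == Some y) F (p.1, behead p.2)).
  rewrite /words_gf mulr_sumr [LHS]big_mkcond big_seq [RHS]big_seq; apply: eq_bigr => w.
  rewrite mem_permutations => ws.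
  have E : \sum_(p <- splits w | ohead p.2 == Some y) F (p.1, behead p.2) =
    if valid j w then (\sum_(p <- splits w | ohead p.2 == Some y)
      q ^+ count_mem y (if left_marks then p.1 else behead p.2)) * q ^+ word_inv w else 0.
    rewrite mulr_suml; case: ifP => vw.
      rewrite big_seq_cond [RHS]big_seq_cond; apply: eq_bigr => -[w1 [|z w2]] /andP[] //=.
      rewrite mem_splits /= => /eqP Ew /eqP[Ez]; rewrite Ez in Ew *.
      by rewrite /F /= Ew vw exprD mulrC.
    rewrite big_seq_cond big1 // => -[w1 [|z w2]] /andP[] //=.
    by rewrite mem_splits /= => /eqP Ew /eqP[Ez]; rewrite Ez in Ew *; rewrite /F /= Ew vw.
  rewrite E; case: ifP => // _; congr (_ * _).
  rewrite -(permP ws); case: left_marks.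
    by rewrite -(sum_marks_left (fun i => q ^+ i) y w 0).
  by rewrite -(sum_marks_right (fun i => q ^+ i) y w).
rewrite sum_marked_permutations /words_gf mulr_sumr [RHS]big_mkcond big_seq [RHS]big_seq.
apply: eq_bigr => w; rewrite mem_permutations => ws.
have E p : p \in splits w -> F p =
  if valid j w && gap y (j < lev y)%N (start j) p then
    f (count act p.1 + count cp p.2)%N * q ^+ word_inv w else 0.
  case: p => w1 w2; rewrite mem_splits /= => /eqP Ew; rewrite /F /=.
  by rewrite valid_insert ?Ew //; case: ifP => // _; rewrite weightP Ew.
rewrite big_seq (eq_bigr _ (fun p => @E p)) -big_seq; case: ifP => vw /=; last by rewrite big1.
rewrite -big_mkcond -mulr_suml; congr (_ * _).
have [||||/= _ ->] := @sum_gaps_from R y (start j) s act cp (j < lev y)%N actP cpP otherP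
  stepP f w (start j) 0%N; rewrite ?mem_head //.
- by move=> x; rewrite (perm_mem ws).
- by case/andP: vw.
- exact: valid_endP.
by rewrite /gap_start /gap_end !add0n -!(permP ws).
Qed.

(** If [s] has a valid arrangement, the gap bounds are in order and the premise applies. Otherwise
    G_j(s) = 0, and the insertion identity makes the left side vanish too, whatever [a] and [b]
    are. *)
Lemma words_gf_factor a b :
  ((gap_start <= gap_end)%N -> (1 - q) * (\sum_(gap_start <= i < gap_end) f i) = q ^+ a - q ^+ b) ->
  (1 - q ^+ (count_mem y s).+1) * words_gf j (y :: s) = (q ^+ a - q ^+ b) * words_gf j s.
Proof.
move=> Ef; have [/hasP[w]|/hasPn nv] := boolP (has (valid j) (permutations s)).
  rewrite mem_permutations => ws /(gap_start_le_end ws)/Ef <-.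
  rewrite -mulrA -words_gf_insert mulrA geometric_sum // expr0.
  by rewrite /= eqxx.
have G0 : words_gf j s = 0.
  by rewrite /words_gf big_seq_cond big1 // => w /andP[/nv/negbTE->].
have := congr1 ( *%R (1 - q)) words_gf_insert.
by rewrite G0 !mulr0 mulrA geometric_sum // expr0 /= eqxx.
Qed.

End Insertion.

Lemma letter_eqE (x y : letter) :
  (x == y) = [&& lev x == lev y, lab x == lab y & dec x == dec y].
Proof. by case: x => [[? ?] ?]; case: y => [[? ?] ?]; rewrite !xpair_eqE -andbA. Qed.

Lemma count_add_in (T : eqType) (a b c : pred T) (w : seq T) :
  {in w, forall x, (a x + b x = c x)%N} -> (count a w + count b w = count c w)%N.
Proof.
elim: w => //= x w IH H; rewrite -IH; last by move=> z zw; apply: H; rewrite inE zw orbT.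
by rewrite -H ?mem_head // addnACA.
Qed.

Lemma lev_start j : lev (start j) = j. Proof. by []. Qed.
Lemma lab_start j : lab (start j) = 0%N. Proof. by []. Qed.

(** * Three removal rules: a decorated, a topmost and a bottommost letter *)

Section Removal.
Variables (R : comNzRingType) (q : R).
Implicit Types (j : nat) (y x p : letter) (s : seq letter).
Local Notation G := (words_gf q).

Ltac letters := rewrite ?letter_eqE /step /attacks ?lev_start ?lab_start; lia.

Definition valley_inv y s : nat := count (fun x => ~~ dec x && attacks x y) s.

(** The [act] letters are the undecorated letters attacking [y]. Those on the left of [y] are its
    inversions, and the mark adds the copies of [y] on its right, which are the [cp] letters. *)
Lemma remove_decorated j y s :
  dec y -> [|| s != [::], (j < lev y)%N | step (start j) y] ->
  (1 - q ^+ (count_mem y s).+1) * G j (y :: s)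
  = (q ^+ (count_mem y s + ~~ step (start j) y) - q ^+ (valley_inv y s + (j < lev y)%N)) * G j s.
Proof.
move=> dy sne.
pose act x := ~~ dec x && attacks x y.
have actP x : x \in s -> act x -> step x y && step y x by move=> _; rewrite /act; letters.
have cpP x : x \in s -> pred1 y x -> ~~ step x y && ~~ step y x.
  by move=> _ /eqP->; letters.
have otherP x : x \in s -> ~~ act x -> ~~ pred1 y x -> step x y = ~~ step y x.
  by move=> _; rewrite /= letter_eqE dy /act; case dx : (dec x); letters.
have stepP p x : p \in start j :: s -> x \in s -> step p x -> step p y || step y x.
  by move=> _ _; letters.
have step_trans p x : p \in start j :: s -> x \in s -> step p y -> step y x -> step p x.
  by move=> _ _; letters.
have step_end p : p \in s -> step p y -> (j < lev y)%N -> (j < lev p)%N.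
  by move=> _; letters.
have weightP w1 w2 : perm_eq (w1 ++ w2) s ->
  q ^+ (word_inv (w1 ++ y :: w2) + count_mem y (if false then w1 else w2)) =
  q ^+ (count act w1 + count (pred1 y) w2) * q ^+ word_inv (w1 ++ w2).
  by move=> _; rewrite word_inv_insert dy addn0 -exprD addnAC.
apply: (words_gf_factor actP cpP otherP stepP step_trans step_end sne (q := q) (left_marks := false) (f := fun i => q ^+ i) weightP).
exact: geometric_sum.
Qed.

Definition up_window y s : nat :=
  count (fun x => (lev x == lev y) || ((lev x).+1 == lev y) && (lab x < lab y)%N) s.

(** No other letter attacks [y], so an insertion gains the [act] letters on its right, the copies
    among them being counted by the mark. The last hypothesis protects the end of the word: a final
    [y] of level [j.+1] could otherwise follow a letter of level [j], with which no valid word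
    ends. *)
Lemma remove_top j y s :
  ~~ dec y -> (j < lev y)%N ->
  {in s, forall x, ~~ dec x &&
    ((lev x < lev y)%N || (lev x == lev y) && (lab y <= lab x)%N)} ->
  (lev y = j.+1 -> {in s, forall x, j < lev x}%N) ->
  (1 - q ^+ (count_mem y s).+1) * G j (y :: s)
  = (1 - q ^+ (up_window y s + step (start j) y)) * G j s.
Proof.
move=> dy jy sy sj.
pose act x := (lev x == lev y) || ((lev x).+1 == lev y) && (lab x < lab y)%N.
have actP x : x \in s -> act x -> step x y && step y x.
  by move=> /sy; rewrite /act; clear -dy; letters.
have cpP x : x \in s -> pred0 x -> ~~ step x y && ~~ step y x by [].
have otherP x : x \in s -> ~~ act x -> ~~ pred0 x -> step x y = ~~ step y x.
  by move=> /sy + + _; rewrite /act; clear -dy; letters.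
have stepP p x : p \in start j :: s -> x \in s -> step p x -> step p y || step y x.
  by move=> _ /sy + _; clear -dy; letters.
have step_trans p x : p \in start j :: s -> x \in s -> step p y -> step y x -> step p x.
  rewrite inE => /orP[/eqP->|/sy].
    move=> xs; move: (sy _ xs) (fun e => sj e x xs); clear -dy jy.
    case: (eqVneq (lev y) j.+1) => [e /[swap] /(_ e)|ne _]; last by move: ne; letters.
    by move: e; letters.
  by move=> + /sy; clear -dy; letters.
have step_end p : p \in s -> step p y -> (j < lev y)%N -> (j < lev p)%N.
  move=> ps; move: (sy _ ps) (fun e => sj e p ps); clear -dy.
  case: (eqVneq (lev y) j.+1) => [e /[swap] /(_ e)|ne _]; last by move: ne; letters.
  by move: e; letters.
have sne : [|| s != [::], (j < lev y)%N | step (start j) y] by rewrite jy orbT.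
have weightP w1 w2 : perm_eq (w1 ++ w2) s ->
  q ^+ (word_inv (w1 ++ y :: w2) + count_mem y (if false then w1 else w2)) =
  q ^+ (count act s - (count act w1 + count pred0 w2)) * q ^+ word_inv (w1 ++ w2).
  move=> ws; rewrite word_inv_insert (negbTE dy) -exprD -(permP ws) count_cat; congr (_ ^+ _).
  have syw x : x \in w1 ++ w2 -> _ := fun xw => sy x (eq_ind _ is_true xw _ (perm_mem ws x)).
  have -> : count (fun x => ~~ dec x && attacks x y) w1 = 0%N.
    apply/eqP; rewrite -leqn0 leqNgt -has_count; apply/hasPn => x xw.
    by have := syw x; rewrite mem_cat xw => /(_ isT); clear -dy; letters.
  have <- : (count (attacks y) w2 + count_mem y w2 = count act w2)%N.
    apply: count_add_in => x xw; have := syw x; rewrite mem_cat xw orbT => /(_ isT).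
    by rewrite /act /= letter_eqE (negbTE dy) => /andP[/negbTE-> +]; clear; letters.
  by rewrite count_pred0; lia.
rewrite -(expr0 q).
apply: (words_gf_factor actP cpP otherP stepP step_trans step_end sne (q := q) (left_marks := false) (f := fun i => q ^+ (count act s - i)) weightP).
(* The exponent falls along the gaps; reversing the sum gives a geometric sum from exponent 0,
   shorter by one term when [y] cannot come first. *)
rewrite /gap_start /gap_end jy count_pred0 add0n /up_window -/act => _.
case: (step _ y) => /=.
  rewrite addn1 big_nat_rev /= -geometric_sum //; congr (_ * _).
  by apply: eq_big_nat => i; rewrite add0n subSS => /andP[_ ?]; congr (_ ^+ _); lia.
rewrite addn0 addn1 big_add1 /= big_nat_rev /= -geometric_sum //; congr (_ * _).
by apply: eq_big_nat => i /andP[_ ?]; congr (_ ^+ _); lia.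
Qed.

Definition down_window y s : nat :=
  count (fun x => (lev x == lev y) || (lev x == (lev y).+1) && (lab y < lab x)%N) s.

(** Mirror image of the rule for a top letter: [y] attacks nothing else, so an insertion gains the
    [act] letters on its left. Being at a negative height, [y] may always come first and never
    last. *)
Lemma remove_bottom j y s :
  ~~ dec y -> (lev y <= j)%N ->
  {in s, forall x, ~~ dec x &&
    ((lev y < lev x)%N || (lev x == lev y) && (lab x <= lab y)%N)} ->
  (1 - q ^+ (count_mem y s).+1) * G j (y :: s) = (1 - q ^+ down_window y s) * G j s.
Proof.
move=> dy jy sy.
pose act x := (lev x == lev y) || (lev x == (lev y).+1) && (lab y < lab x)%N.
have actP x : x \in s -> act x -> step x y && step y x.
  by move=> /sy; rewrite /act; clear -dy; letters.
have cpP x : x \in s -> pred0 x -> ~~ step x y && ~~ step y x by [].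
have otherP x : x \in s -> ~~ act x -> ~~ pred0 x -> step x y = ~~ step y x.
  by move=> /sy + + _; rewrite /act; clear -dy; letters.
have stepP p x : p \in start j :: s -> x \in s -> step p x -> step p y || step y x.
  rewrite inE => /orP[/eqP->|/sy]; first by clear -dy jy; letters.
  by move=> + /sy; clear -dy; letters.
have step_trans p x : p \in start j :: s -> x \in s -> step p y -> step y x -> step p x.
  rewrite inE => /orP[/eqP->|/sy].
    by move=> /sy; clear -dy jy; letters.
  by move=> + /sy; clear -dy; letters.
have step_end p : p \in s -> step p y -> (j < lev y)%N -> (j < lev p)%N by lia.
have stP : step (start j) y by clear -dy jy; letters.
have sne : [|| s != [::], (j < lev y)%N | step (start j) y] by rewrite stP !orbT.
have weightP w1 w2 : perm_eq (w1 ++ w2) s ->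
  q ^+ (word_inv (w1 ++ y :: w2) + count_mem y (if true then w1 else w2)) =
  q ^+ (count act w1 + count pred0 w2) * q ^+ word_inv (w1 ++ w2).
  move=> ws; rewrite word_inv_insert (negbTE dy) -exprD count_pred0 addn0; congr (_ ^+ _).
  have syw x : x \in w1 ++ w2 -> _ := fun xw => sy x (eq_ind _ is_true xw _ (perm_mem ws x)).
  have -> : count (attacks y) w2 = 0%N.
    apply/eqP; rewrite -leqn0 leqNgt -has_count; apply/hasPn => x xw.
    by have := syw x; rewrite mem_cat xw orbT => /(_ isT); clear -dy; letters.
  have <- : (count (fun x => ~~ dec x && attacks x y) w1 + count_mem y w1 = count act w1)%N.
    apply: count_add_in => x xw; have := syw x; rewrite mem_cat xw => /(_ isT).
    by rewrite /act /= letter_eqE (negbTE dy) => /andP[/negbTE-> +]; clear; letters.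
  by lia.
rewrite -(expr0 q).
apply: (words_gf_factor actP cpP otherP stepP step_trans step_end sne (q := q) (left_marks := true) (f := fun i => q ^+ i) weightP).
by rewrite /gap_start /gap_end stP count_pred0 ltnNge jy /= !addn0 => _; exact: geometric_sum.
Qed.
End Removal.

(** * Comparison of the shifts *)

Section Undecorated.
Variables (R : idomainType) (q : R).
Hypothesis q_gen : forall n, q ^+ n.+1 != 1.
Implicit Types (j c : nat) (x y : letter) (s l : seq letter).
Local Notation G := (words_gf q).
Local Notation omq n := (1 - q ^+ n).

Lemma omq_neq0 n : (0 < n)%N -> omq n != 0.
Proof. by case: n => // n _; rewrite subr_eq0 eq_sym q_gen. Qed.

(** The product of (q;q)_c over the multiplicities c of the distinct elements of [l]. It collects
    the factors on the left of the removal rules. *)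
Fixpoint repeats_poch (T : eqType) (l : seq T) : R :=
  if l is x :: l' then omq (count_mem x l').+1 * repeats_poch l' else 1.
Local Notation den := repeats_poch.

Lemma repeats_poch_neq0 (T : eqType) (l : seq T) : den l != 0.
Proof. by elim: l => [|x l IH] /=; rewrite ?oner_neq0 // mulf_neq0 ?omq_neq0. Qed.

Lemma repeats_poch_insert (T : eqType) (y : T) (l1 l2 : seq T) :
  den (l1 ++ y :: l2) = omq (count_mem y (l1 ++ l2)).+1 * den (l1 ++ l2).
Proof.
elim: l1 => //= x l1 IH; rewrite IH !mulrA; congr (_ * _).
rewrite !count_cat /= (eq_sym y x).
case: eqVneq => [->|_] /=; last by rewrite mulrC !add0n.
by congr (omq _ * omq _); rewrite addnCA.
Qed.

Lemma eq_repeats_poch (T : eqType) (l1 l2 : seq T) : perm_eq l1 l2 -> den l1 = den l2.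
Proof.
elim: l1 l2 => [|x l1 IH] l2 p12.
  by move: p12; rewrite perm_sym => /perm_nilP->.
have xl2 : x \in l2 by rewrite -(perm_mem p12) mem_head.
case/splitPr: xl2 p12 => a b p12.
have {}p12 : perm_eq l1 (a ++ b).
  by move: p12; rewrite perm_sym (perm_catCA a [:: x]) perm_cons perm_sym.
by rewrite repeats_poch_insert /= (IH _ p12) (permP p12).
Qed.

Section Walk.
Variable (T : Type) (B : pred T).
Implicit Types (t : seq T).

(** With [c] the number of letters outside [B] already passed, [count B t' + c] is the window of the
    current letter: the letters of [B] after it and the others before it. [walk_up] collects the
    factors of the letters of [B], [walk_down] those of the others. *)
Fixpoint walk_up t c : R :=
  if t is x :: t' then
    if B x then omq (count B t' + c) * walk_up t' c else walk_up t' c.+1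
  else 1.

Fixpoint walk_down t c : R :=
  if t is x :: t' then
    if B x then walk_down t' c else omq (count B t' + c) * walk_down t' c.+1
  else 1.

Definition qfact n : R := \prod_(i < n) omq i.+1.

Lemma qfact_neq0 n : qfact n != 0.
Proof. by apply/prodf_neq0 => i _; apply: omq_neq0. Qed.

Lemma qfactS n : qfact n.+1 = qfact n * omq n.+1.
Proof. by rewrite /qfact big_ord_recr. Qed.

(* Along the walk n = count B t + c goes up by 1 at each letter outside B and
   down by 1 at each letter of B; both products telescope. *)
Lemma walk_telescope t c :
  qfact (count B t + c) * walk_down t c * omq (count (predC B) t + c)
  = qfact (count (predC B) t + c) * walk_up t c * omq (count B t + c).
Proof.
elim: t c => [|x t IH] c /=; first by rewrite mulr1.
case: (B x) => /=; rewrite ?add0n.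
  have := IH c; rewrite add1n addSn qfactS; set f := (_ + c)%N; set g := (_ + c)%N => IHc.
  transitivity (omq f.+1 * (qfact f * walk_down t c * omq g)); first by ring.
  by rewrite IHc; ring.
have := IH c.+1; rewrite !addnS add1n addSn qfactS.
set f := (_ + c)%N; set g := (_ + c)%N => IHc.
apply: (mulfI (omq_neq0 (ltn0Sn f))).
transitivity (omq f * (qfact f * omq f.+1 * walk_down t c.+1 * omq g.+1)); first by ring.
by rewrite IHc; ring.
Qed.

(** The letters after [x] lie in [B] and give no factor, and those before [x] only count letters of
    [B] after them; so only the factor of [x] itself disappears. *)
Lemma walk_down_insert t1 (x : T) t2 c : ~~ B x -> all B t2 ->
  walk_down (t1 ++ x :: t2) c
  = omq (size t2 + count (predC B) t1 + c) * walk_down (t1 ++ t2) c.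
Proof.
move=> /negbTE Bx Bt2; elim: t1 c => [|z t1 IH] c /=.
  rewrite Bx addn0 (eqP (_ : count B t2 == size t2)) -?all_count //; congr (_ * _).
  by elim: t2 Bt2 c => //= z t2 IH /andP[-> Bt2] c; rewrite IH.
case: (B z) => /=; first by rewrite IH add0n.
by rewrite IH !count_cat /= Bx add0n mulrCA addnS addSn addnS addnA.
Qed.
End Walk.

(** Equal to (q;q)_n (1 - q^u) / (1 - q^n) for u <= n and n > 0; this form avoids the division. *)
Definition base_poch u n : R := (\prod_(i < u) omq i.+1) * \prod_(u <= i < n) omq i.

Lemma base_pochE u n : (u <= n)%N -> omq n * base_poch u n = omq u * qfact n.
Proof.
rewrite /base_poch => /subnKC <-; elim: (n - u)%N => [|k IH].
  by rewrite addn0 big_geq // mulr1.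
by rewrite addnS big_nat_recr ?leq_addr //= qfactS !mulrA -IH; ring.
Qed.

Definition upos h s : nat := count (fun x => [&& lev x == h, (0 < lab x)%N & ~~ dec x]) s.

Ltac letters := rewrite ?letter_eqE /step /attacks ?lev_start ?lab_start; lia.

(** Letters are removed by increasing label with [remove_top]. On the main diagonal a zero label may
    not open the word, so it has one gap fewer than a positive label; this is the index shift in
    [base_poch]. *)
Lemma words_gf_base j s : {in s, forall x, ~~ dec x && (lev x == j.+1)} ->
  G j s * den s = base_poch (upos j.+1 s) (size s).
Proof.
pose r x y := (lab x <= lab y)%N.
have r_tot : total r by move=> x y; rewrite /r; lia.
have r_tr : transitive r by move=> x y z; rewrite /r; lia.
have [n] := ubnP (size s); elim: n => // n IH in s *; rewrite ltnS => sn ss.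
have ps : perm_eq s (sort r s) by rewrite perm_sym perm_sort.
have srt := sort_sorted r_tot s.
rewrite (eq_words_gf q j ps) (eq_repeats_poch ps) /upos (permP ps) (perm_size ps).
rewrite (perm_size ps) in sn; have {}ss x : x \in sort r s -> _ := fun xs =>
  ss x (eq_ind_r _ xs (perm_mem ps x)).
case: (sort r s) srt sn ss => [|y s'] /= srt sn ss.
  rewrite /base_poch /= big_ord0 big_geq // !mulr1 /words_gf.
  have -> : permutations ([::] : seq letter) = [:: [::]] by [].
  by rewrite big_cons big_nil /valid /= lev_start ltnSn expr0 addr0.
have ys' x : x \in s' -> (lab y <= lab x)%N by move/allP: (order_path_min r_tr srt); apply.
have ss' x : x \in s' -> ~~ dec x && (lev x == j.+1) by move=> xs; apply: ss; rewrite inE xs orbT.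
have /andP[dy /eqP jy] := ss y (mem_head _ _).
have topP := @remove_top _ q j y s' dy.
have {}topP : omq (count_mem y s').+1 * G j (y :: s') = omq (size s' + (0 < lab y)%N) * G j s'.
  rewrite topP ?jy //; first last.
  - by move=> _ x /ss'/andP[_ /eqP->].
  - by move=> x xs; move: (ss' _ xs) (ys' _ xs); clear -jy; lia.
  congr (omq (_ + _) * _); last by rewrite /step jy lev_start lab_start dy; lia.
  by apply/eqP; rewrite /up_window -all_count; apply/allP => x /ss'/andP[_]; rewrite jy => ->.
rewrite mulrCA mulrA topP -mulrA IH // ?(leq_trans _ sn) //.
rewrite jy eqxx dy andbT /= /upos; set u := count _ s'.
have us : (u <= size s')%N by rewrite count_size.
case: (posnP (lab y)) => y0 /=.
  by rewrite addn0 add0n /base_poch mulrC [in RHS]big_nat_recr //= mulrA.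
have -> : u = size s'.
  apply/eqP; rewrite -all_count; apply/allP => x xs.
  by move: (ss' _ xs) (ys' _ xs); clear -y0; lia.
by rewrite /base_poch addn1 add1n !big_geq // !mulr1 big_ord_recr /= mulrC.
Qed.

(* On the two diagonals j+1 and j+2 list the letters by increasing label, those of
   level j+2 first in case of equality. *)
Definition merge_rel x y := (lab x < lab y)%N || (lab x == lab y) && (lev y <= lev x)%N.

Section TwoDiagonals.
Variable j : nat.
Let B x := lev x == j.+2.
Let two s := {in s, forall x, ~~ dec x && ((lev x == j.+1) || (lev x == j.+2))}.

(** For shift [j] the letters of level [j.+2] are removed from left to right. In the order
    [merge_rel] the window of such a letter consists of [t1], the letters one level below with a
    smaller label, and of the letters of its own level still in [t2]. *)
Lemma words_gf_walk_up t1 t2 :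
  two (t1 ++ t2) -> pairwise merge_rel (t1 ++ t2) -> all (predC B) t1 ->
  G j (t1 ++ t2) * den (t1 ++ t2)
  = walk_up B t2 (size t1) *
    (G j (filter (predC B) (t1 ++ t2)) * den (filter (predC B) (t1 ++ t2))).
Proof.
elim: t2 t1 => [|x t2 IH] t1.
  by rewrite cats0 /= => _ _ /all_filterP->; rewrite mul1r.
move=> tw pw At1; have tx : x \in t1 ++ x :: t2 by rewrite mem_cat mem_head orbT.
rewrite /=; case: ifP => Bx; last first.
  by rewrite -cat_rcons -(size_rcons t1 x) IH ?cat_rcons // all_rcons At1 /= Bx.
have px : perm_eq (t1 ++ x :: t2) (x :: t1 ++ t2) by rewrite (perm_catCA t1 [:: x]).
have /andP[dx _] := tw x tx.
move: (pw); rewrite pairwise_cat allrel_consr /= => /and3P[/andP[/allP t1x t12] pt1 /andP[/allP xt2 pt2]].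
have tw' : two (t1 ++ t2) by move=> z zt; apply: tw; rewrite (perm_mem px) inE zt orbT.
have Ef : filter (predC B) (t1 ++ x :: t2) = filter (predC B) (t1 ++ t2).
  by rewrite !filter_cat /= Bx.
rewrite Ef (eq_words_gf q j px) repeats_poch_insert mulrCA mulrA remove_top //.
- rewrite -mulrA IH //; last by rewrite pairwise_cat t12 pt1 pt2.
  rewrite mulrA; congr (omq _ * _ * _).
  have -> : step (start j) x = false by move: Bx; rewrite /B; letters.
  rewrite addn0 /up_window count_cat addnC; congr (_ + _)%N.
    apply: eq_in_count => z zt; move: (tw' z); rewrite mem_cat zt orbT => /(_ isT).
    by move: (xt2 z zt) Bx; rewrite /B /merge_rel; clear; lia.
  apply/eqP; rewrite -all_count; apply/allP => z zt.
  move: (allP At1 z zt) (t1x z zt) (tw' z); rewrite mem_cat zt => + + /(_ isT).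
  by move: Bx; rewrite /= /B /merge_rel; clear; lia.
- by move: Bx; rewrite /B; lia.
- move=> z; rewrite mem_cat => /orP[] zt; move: (tw' z); rewrite mem_cat zt ?orbT => /(_ isT).
    by move: (allP At1 z zt) Bx; rewrite /= /B; clear; lia.
  by move: (xt2 z zt) Bx; rewrite /merge_rel /B; clear; lia.
by move: Bx; rewrite /B; lia.
Qed.

(** For shift [j.+1] the letters of level [j.+1] have negative height and are removed from right to
    left with [remove_bottom]. The window consists of [t2], the letters one level above with a
    larger label, and of the letters of the same level in [t1]. *)
Lemma words_gf_walk_down t1 t2 :
  two (t1 ++ t2) -> pairwise merge_rel (t1 ++ t2) -> all B t2 ->
  G j.+1 (t1 ++ t2) * den (t1 ++ t2)
  = walk_down B (t1 ++ t2) 0 *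
    (G j.+1 (filter B (t1 ++ t2)) * den (filter B (t1 ++ t2))).
Proof.
elim/last_ind: t1 t2 => [|t1 x IH] t2 /=.
  move=> _ _ Bt2; have -> : walk_down B t2 0 = 1.
    by elim: t2 Bt2 => //= z t2 IH /andP[-> /IH].
  by move/all_filterP: Bt2 => ->; rewrite mul1r.
rewrite cat_rcons => tw pw Bt2; have tx : x \in t1 ++ x :: t2 by rewrite mem_cat mem_head orbT.
case Bx: (B x); first by rewrite IH //= Bx.
have px : perm_eq (t1 ++ x :: t2) (x :: t1 ++ t2) by rewrite (perm_catCA t1 [:: x]).
have /andP[dx jx] := tw x tx.
move: (pw); rewrite pairwise_cat allrel_consr /= => /and3P[/andP[/allP t1x t12] pt1 /andP[/allP xt2 pt2]].
have tw' : two (t1 ++ t2) by move=> z zt; apply: tw; rewrite (perm_mem px) inE zt orbT.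
have Ef : filter B (t1 ++ x :: t2) = filter B (t1 ++ t2).
  by rewrite !filter_cat /= Bx.
rewrite Ef (eq_words_gf q j.+1 px) repeats_poch_insert mulrCA mulrA remove_bottom //.
- rewrite -mulrA IH //; last by rewrite pairwise_cat t12 pt1 pt2.
  rewrite mulrA walk_down_insert ?Bx //; congr (omq _ * _ * _).
  rewrite addn0 /down_window count_cat addnC; congr (_ + _)%N.
    apply/eqP; rewrite -all_count; apply/allP => z zt.
    move: (allP Bt2 z zt) (xt2 z zt) jx Bx.
    by rewrite /= /B /merge_rel; clear; lia.
  apply: eq_in_count => z zt; move: (tw' z); rewrite mem_cat zt => /(_ isT).
  by move: (t1x z zt) jx Bx; rewrite /= /B /merge_rel; clear; lia.
- by move: jx Bx; rewrite /B; lia.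
move=> z; rewrite mem_cat => /orP[] zt; move: (tw' z); rewrite mem_cat zt ?orbT => /(_ isT).
  by move: (t1x z zt) jx Bx; rewrite /merge_rel /= /B; clear; lia.
by move: (xt2 z zt) (allP Bt2 z zt) jx Bx; rewrite /merge_rel /= /B; clear; lia.
Qed.

Lemma words_gf_two_diagonals s : two s ->
  omq (upos j.+1 s) * G j.+1 s = omq (upos j.+2 s) * G j s.
Proof.
move=> tw.
have r_tot : total merge_rel by move=> x y; rewrite /merge_rel; lia.
have r_tr : transitive merge_rel by move=> x y z; rewrite /merge_rel; lia.
have ps : perm_eq s (sort merge_rel s) by rewrite perm_sym perm_sort.
have srt := sort_sorted r_tot s.
rewrite !(eq_words_gf q _ ps) /upos !(permP ps).
have {}tw : two (sort merge_rel s) by move=> x; rewrite -(perm_mem ps); apply: tw.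
move: (sort _ s) tw srt => t tw; rewrite (sorted_pairwise r_tr) => pw {s ps}.
have tmem (C : pred letter) : {subset filter C t <= t} by move=> x; rewrite mem_filter => /andP[].
have := words_gf_walk_up (t1 := [::]) tw pw isT.
have := words_gf_walk_down (t1 := t) (t2 := [::]); rewrite !cats0 /= => /(_ tw pw isT).
rewrite (@words_gf_base j.+1 (filter B t)); last first.
  by move=> x; rewrite mem_filter /B => /andP[/eqP-> /tw/andP[-> _]] /=.
rewrite (@words_gf_base j (filter (predC B) t)); last first.
  by move=> x; rewrite mem_filter /= /B => /andP[+ /tw]; lia.
have -> : upos j.+1 (filter (predC B) t) = upos j.+1 t.
  rewrite /upos count_filter; apply: eq_count => x; rewrite /= /B.
  by case: eqVneq => //= ->; rewrite ltn_eqF // andbT.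
have -> : upos j.+2 (filter B t) = upos j.+2 t.
  by rewrite /upos count_filter; apply: eq_count => x; rewrite /= /B; case: eqVneq => //=; rewrite andbT.
rewrite !size_filter -/(upos j.+1 t) -/(upos j.+2 t).
have walkE := walk_telescope B t 0; rewrite !addn0 in walkE.
have ua : (upos j.+1 t <= count (predC B) t)%N.
  by apply: sub_count => x /= /and3P[/eqP jx _ _]; rewrite /B jx ltn_eqF.
have ub : (upos j.+2 t <= count B t)%N by apply: sub_count => x /= /and3P[].
have ea := base_pochE ua; have eb := base_pochE ub.
move: (count (predC B) t) (count B t) (upos j.+1 t) (upos j.+2 t) walkE ua ub ea eb.
move=> a b u v walkE ua ub ea eb Ed Eu.
apply: (mulIf (repeats_poch_neq0 t)); rewrite -!mulrA Ed Eu.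
(* The general case cancels (1 - q^a)(1 - q^b), so an empty diagonal is treated apart. Then a factor
   1 - q^0 in [walkE] kills one walk product when the other diagonal is not empty. *)
case: (posnP a) => [a0|a_gt0].
  have u0 : u = 0%N by lia.
  have v0 : v = 0%N \/ walk_up B t 0 = 0.
    case: (posnP b) => [b0|b_gt0]; [left; lia|right].
    move/eqP: walkE; rewrite a0 expr0 subrr mulr0 eq_sym !mulf_eq0.
    by rewrite (negbTE (qfact_neq0 _)) (negbTE (omq_neq0 _)) // orbF => /eqP.
  rewrite u0 expr0 subrr mul0r; case: v0 => ->; last by rewrite !(mul0r, mulr0).
  by rewrite expr0 subrr mul0r.
case: (posnP b) => [b0|b_gt0].
  have v0 : v = 0%N by lia.
  have u0 : walk_down B t 0 = 0.
    move/eqP: walkE; rewrite b0 expr0 subrr mulr0 !mulf_eq0.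
    by rewrite (negbTE (qfact_neq0 _)) (negbTE (omq_neq0 _)) // orbF => /eqP.
  by rewrite v0 u0 expr0 subrr !(mul0r, mulr0).
apply: (mulIf (mulf_neq0 (omq_neq0 a_gt0) (omq_neq0 b_gt0))).
transitivity (omq u * walk_down B t 0 * omq a * (omq b * base_poch v b)); first by ring.
rewrite eb; transitivity (omq u * omq v * (qfact b * walk_down B t 0 * omq a)); first by ring.
rewrite walkE; transitivity (omq v * walk_up B t 0 * omq b * (omq u * qfact a)); first by ring.
by rewrite -ea; ring.
Qed.
End TwoDiagonals.
End Undecorated.

Lemma ex_perm_least (T : eqType) (r : rel T) (s : seq T) :
  total r -> transitive r -> s != [::] ->
  exists y s', perm_eq s (y :: s') /\ {in s', forall x, r y x}.
Proof.
move=> r_tot r_tr; have ps : perm_eq s (sort r s) by rewrite perm_sym perm_sort.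
have := sort_sorted r_tot s; case: (sort r s) ps => [/perm_nilP-> //|y s'] ps srt _.
by exists y, s'; split=> //; apply/allP/order_path_min.
Qed.

(** * Contents on arbitrarily many diagonals *)

Section Diagonals.
Variables (R : fieldType) (q : R).
Hypothesis q_gen : forall n, q ^+ n.+1 != 1.
Implicit Types (j h : nat) (x y : letter) (s w : seq letter).
Local Notation G := (words_gf q).
Local Notation omq n := (1 - q ^+ n).
Local Notation omqI n := (mulfI (omq_neq0 q_gen (ltn0Sn n))).

Lemma perm_upos s s' h : perm_eq s s' -> upos h s = upos h s'.
Proof. by move=> ss'; rewrite /upos (permP ss'). Qed.

(** A letter above level [j.+2], or of level at most [j], is removed with the same factor for both
    shifts and does not affect the two [upos]; this reduces the claim to two diagonals. *)
Lemma words_gf_shift j s : all (predC dec) s ->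
  omq (upos j.+1 s) * G j.+1 s = omq (upos j.+2 s) * G j s.
Proof.
have [n] := ubnP (size s); elim: n => // n IH in s *; rewrite ltnS => sn us.
have [->|s0] := eqVneq s [::]; first by rewrite /= subrr !mul0r.
pose top y x := (lev x < lev y)%N || (lev x == lev y) && (lab y <= lab x)%N.
have [||//|y [t [st topt]]] := @ex_perm_least _ top s.
- by move=> x y; rewrite /top; lia.
- by move=> x y z; rewrite /top; lia.
have [yj|yj] := ltnP j.+2 (lev y).
  rewrite !(perm_upos _ st) !(eq_words_gf q _ st); rewrite (perm_size st) in sn.
  have /andP[dy ut] : all (predC dec) (y :: t) by rewrite -(perm_all _ st).
  have [-> ->] : upos j.+1 (y :: t) = upos j.+1 t /\ upos j.+2 (y :: t) = upos j.+2 t.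
    by rewrite /upos /=; clear -yj; lia.
  apply: (omqI (count_mem y t)); rewrite !(mulrCA (omq (count_mem y t).+1)).
  rewrite !remove_top //; try lia.
  - have stE i : (i <= j.+1)%N -> step (start i) y = false.
      by move=> ij; rewrite /step lev_start; lia.
    rewrite !stE // mulrCA [RHS]mulrCA; congr (_ * _); exact: IH.
  - by move=> x xt; move: (allP ut x xt) (topt x xt); rewrite /top /=; lia.
  - by move=> x xt; move: (allP ut x xt) (topt x xt); rewrite /top /=; lia.
have low x : x \in s -> (lev x <= j.+2)%N.
  rewrite (perm_mem st) inE => /orP[/eqP-> //|/topt]; rewrite /top; lia.
pose bot y x := (lev y < lev x)%N || (lev x == lev y) && (lab x <= lab y)%N.
have [||//|z [t' [st' bott]]] := @ex_perm_least _ bot s.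
- by move=> a b; rewrite /bot; lia.
- by move=> a b c; rewrite /bot; lia.
have [zj|zj] := leqP (lev z) j.
  rewrite !(perm_upos _ st') !(eq_words_gf q _ st'); rewrite (perm_size st') in sn.
  have /andP[dz ut] : all (predC dec) (z :: t') by rewrite -(perm_all _ st').
  have [-> ->] : upos j.+1 (z :: t') = upos j.+1 t' /\ upos j.+2 (z :: t') = upos j.+2 t'.
    by rewrite /upos /=; clear -zj; lia.
  apply: (omqI (count_mem z t')); rewrite !(mulrCA (omq (count_mem z t').+1)).
  rewrite !remove_bottom //; try lia.
  - rewrite mulrCA [RHS]mulrCA; congr (_ * _); exact: IH.
  - by move=> x xt; move: (allP ut x xt) (bott x xt); rewrite /bot /=; lia.
  - by move=> x xt; move: (allP ut x xt) (bott x xt); rewrite /bot /=; lia.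
apply: words_gf_two_diagonals => // x xs.
have /= -> := allP us x xs.
have := low x xs; move: xs; rewrite (perm_mem st') inE => /orP[/eqP->|/bott]; rewrite /bot; lia.
Qed.

(** A discrete intermediate value principle: levels rise by at most one at a time, and only through
    an undecorated positive letter. *)
Lemma step_crossing h p w x : path step p w -> (lev p <= h)%N -> x \in w -> (h < lev x)%N ->
  (0 < upos h.+1 w)%N.
Proof.
elim: w p => //= z w IH p /andP[pz zw] ph; rewrite inE => xw hx.
have [zh|zh] := leqP (lev z) h.
  rewrite /upos /= ltn_eqF ?ltnS //= add0n; apply: (IH z) => //.
  by case/orP: xw => // /eqP xz; move: hx; rewrite xz ltnNge zh.
suff -> : [&& lev z == h.+1, (0 < lab z)%N & ~~ dec z] by [].
by move: pz; rewrite /step; lia.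
Qed.

Lemma words_gf_bottom j s : all (predC dec) s -> (0 < upos 1 s)%N ->
  omq (upos 1 s) * G j s = omq (upos j.+1 s) * G 0 s.
Proof.
move=> us u1; elim: j => // j IH; have shiftE := words_gf_shift j us.
(* If u_(j+1) = 0, division is impossible, but both sides vanish by [step_crossing]: a word of shift
   [j.+1] has to climb from level 1 past level [j.+1], and a Dyck word has to cross level [j.+1] to
   reach level [j.+2]. *)
have [u0|u0] := posnP (upos j.+1 s); last first.
  apply: (mulfI (omq_neq0 q_gen u0)).
  by rewrite mulrCA shiftE mulrCA IH mulrCA.
have -> : G j.+1 s = 0.
  rewrite /words_gf big_seq_cond big1 // => w /andP[]; rewrite mem_permutations => ws /andP[wp wl].
  move: (u1); rewrite -(perm_upos _ ws) -has_count => /hasP[x xw /and3P[/eqP x1 _ _]].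
  case/splitPr: w / xw => w1 w2 in ws wp wl *.
  move: wp wl; rewrite cat_path last_cat /= => /and3P[_ _ w2p] lw.
  have jx : (lev x <= j)%N by rewrite x1; case: (j) u0 => // u0; move: u1; rewrite u0.
  have := @step_crossing j x w2 (last x w2) w2p jx.
  have -> : last x w2 \in w2.
    by have := mem_last x w2; rewrite inE => /orP[/eqP xe|//]; move: lw; rewrite xe; lia.
  move=> /(_ isT (ltnW lw)) uw2; move: u0; rewrite -(perm_upos _ ws) /upos count_cat /=.
  by move/eqP; rewrite !addn_eq0 => /and3P[_ _ /eqP u0]; move: uw2; rewrite /upos u0.
rewrite mulr0; have [->|u2] := posnP (upos j.+2 s); first by rewrite subrr mul0r.
have -> : G 0 s = 0; last by rewrite mulr0.
rewrite /words_gf big_seq_cond big1 // => w /andP[]; rewrite mem_permutations => ws /andP[wp _].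
move: u2; rewrite -(perm_upos _ ws) -has_count => /hasP[x xw /and3P[/eqP x2 _ _]].
by have := @step_crossing j (start 0) w x wp (leq0n _) xw; rewrite (perm_upos _ ws) u0 x2 => /(_ (leqnSn _)).
Qed.

(** * Decorated letters and summation over the shifts *)

Definition dzero h s : nat := count (fun x => [&& lev x == h, lab x == 0%N & dec x]) s.

Definition dlow j s : nat := count (fun x => (lev x <= j)%N && dec x) s.

Lemma valley_inv_zero y s : lab y = 0%N -> valley_inv y s = upos (lev y).+1 s.
Proof.
by move=> y0; apply: eq_count => x; rewrite /attacks y0; case: (dec x); rewrite /= ?andbF ?andbT //; lia.
Qed.

(** Decorated letters are removed one at a time, for shift [j] and shift 0 together. Above level [j]
    the factors agree; at level at most [j] the one for shift 0 has an extra [q], which [dlow]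
    absorbs, except for the zeros of level [j], which produce [dzero]. *)
Lemma words_gf_decorated j s :
  {in s, forall x, (0 < lev x)%N} -> (0 < upos 1 s)%N ->
  omq (upos 1 s) * (q ^+ dlow j s * G j s)
  = (q ^+ dzero j s - q ^+ upos j.+1 s) * G 0 s.
Proof.
have [n] := ubnP (size s); elim: n => // n IH in s *; rewrite ltnS => sn s_gt0 u1.
have [us|] := boolP (all (predC dec) s).
  have nodec (a : pred letter) : (forall x, a x -> dec x) -> count a s = 0%N.
    move=> ad; apply/eqP; rewrite -leqn0 leqNgt -has_count; apply/hasPn => x /(allP us).
    exact/contra/ad.
  rewrite /dlow /dzero !nodec ?expr0 ?mul1r ?words_gf_bottom // => x; first by case/and3P.
  by case/andP.
rewrite -has_predC => /hasP[y ys /negPn dy].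
have [t st] : exists t, perm_eq s (y :: t) by exists (rem y s); apply: perm_to_rem.
have t_gt0 x : x \in t -> (0 < lev x)%N by move=> xt; apply: s_gt0; rewrite (perm_mem st) inE xt orbT.
have y_gt0 : (0 < lev y)%N by apply: s_gt0.
have uE h : upos h s = upos h t by rewrite (perm_upos _ st) /upos /= dy !andbF.
have st_t : (size t < n)%N by move: sn; rewrite (perm_size st).
rewrite !uE in u1 *.
have t0 : t != [::] by case: (t) u1.
have IHt := IH t st_t t_gt0 u1.
have remE i : omq (count_mem y t).+1 * G i s =
  (q ^+ (count_mem y t + ~~ step (start i) y) - q ^+ (valley_inv y t + (i < lev y))) * G i t.
  by rewrite (eq_words_gf q i st) remove_decorated // t0.
have rem0 := remE 0%N; have remj := remE j.
have step0 : step (start 0) y = false by rewrite /step lev_start; lia.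
rewrite step0 y_gt0 /= !addn1 in rem0.
apply: (omqI (count_mem y t)).
rewrite [in RHS]mulrCA rem0 mulrCA (mulrCA _ (q ^+ dlow j s)) remj.
have -> : dlow j s = ((lev y <= j) + dlow j t)%N by rewrite /dlow (permP st) /= dy andbT.
have -> : dzero j s = ((lev y == j) && (lab y == 0%N) + dzero j t)%N.
  by rewrite /dzero (permP st) /= dy andbT.
have [jy|jy] := leqP (lev y) j; last first.
  have -> : step (start j) y = false by rewrite /step lev_start; lia.
  rewrite gtn_eqF // !add0n addn1 /= addn1; set A := q ^+ _.+1 - _.
  transitivity (A * (omq (upos 1 t) * (q ^+ dlow j t * G j t))); first by ring.
  by rewrite IHt mulrCA.
(* The exception: a decorated zero at height -1 is not a contractible first step, so only the first
   power in its factor gets the extra [q]. *)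
have [/andP[/eqP jy' /eqP y0]|yz] := boolP ((lev y == j) && (lab y == 0%N)).
  have -> : step (start j) y = false by rewrite /step lev_start lab_start; lia.
  have -> : count_mem y t = dzero j t.
    apply: eq_count => x; rewrite /= letter_eqE jy' y0 dy; by case: (dec x).
  rewrite valley_inv_zero // jy' /= !add1n addn1 addn0 !exprS.
  set A := q ^+ dzero _ _ in IHt *; set W := q ^+ upos j.+1 t in IHt *.
  transitivity (q * (q * A - W) * (omq (upos 1 t) * (q ^+ dlow j t * G j t))); first by ring.
  by rewrite IHt; ring.
have -> : step (start j) y by rewrite /step lev_start lab_start; move: jy yz; rewrite dy; clear; lia.
rewrite !addn0 add0n add1n !exprS.
set A := q ^+ count_mem y t; set W := q ^+ valley_inv y t; set B := q ^+ dlow _ _.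
transitivity (q * (A - W) * (omq (upos 1 t) * (B * G j t))); first by ring.
by rewrite IHt; ring.
Qed.

(** Removing a decorated zero of level [h] gives a factor that vanishes as soon as the remaining
    ones number exactly u_(h+1). Starting with more of them, the removals meet this value. *)
Lemma words_gf0_dzero h s : (0 < h)%N -> (upos h.+1 s < dzero h s)%N -> G 0 s = 0.
Proof.
move=> h_gt0; have [n] := ubnP (size s); elim: n => // n IH in s *; rewrite ltnS => sn uz.
have /hasP[y ys /and3P[/eqP yh /eqP y0 dy]] : has (fun x => [&& lev x == h, lab x == 0%N & dec x]) s.
  by rewrite has_count (leq_ltn_trans _ uz).
have [t st] : exists t, perm_eq s (y :: t) by exists (rem y s); apply: perm_to_rem.
have remE := @remove_decorated _ q 0 y t dy.
have step0 : step (start 0) y = false by rewrite /step lev_start; lia.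
rewrite step0 yh h_gt0 orbT valley_inv_zero // yh /= !addn1 in remE.
apply: (omqI (count_mem y t)); rewrite (eq_words_gf q 0 st) remE // mulr0.
have cz : count_mem y t = dzero h t.
  apply: eq_count => x; rewrite /= letter_eqE yh y0 dy; by case: (dec x).
have uE : upos h.+1 s = upos h.+1 t by rewrite (perm_upos _ st) /upos /= dy !andbF.
have zE : dzero h s = (dzero h t).+1 by rewrite /dzero (permP st) /= yh y0 dy eqxx.
move: uz; rewrite uE zE ltnS leq_eqVlt => /orP[/eqP->|uz].
  by rewrite cz subrr mul0r.
by rewrite IH ?mulr0 //; move: sn; rewrite (perm_size st).
Qed.

(** For shift [j], levels at most [j] are the negative heights: this is the second term of
    [dinv]. *)
Definition plow j s : nat := count (fun x => (lev x <= j)%N && (0 < lab x)%N) s.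

Lemma sum_words_gf B r N s :
  q != 0 -> {in s, forall x, (0 < lev x < B)%N} -> upos 1 s = r -> (0 < r)%N ->
  count (fun x => (0 < lab x)%N && ~~ dec x) s
    = (count (fun x => (lab x == 0%N) && dec x) s + N)%N ->
  omq r * \sum_(j < B) q ^+ plow j s * G j s = omq N * G 0 s.
Proof.
move=> q0 sB ur r0 UZ; subst r.
have s_gt0 : {in s, forall x, (0 < lev x)%N} by move=> x /sB/andP[].
pose X j := count (fun x => [&& (lev x <= j)%N, (0 < lab x)%N & ~~ dec x]) s.
pose Z j := count (fun x => [&& (lev x < j)%N, lab x == 0%N & dec x]) s.
have XS j : X j.+1 = (X j + upos j.+1 s)%N.
  by rewrite /upos; symmetry; apply: count_add_in => x _; lia.
have ZS j : Z j.+1 = (Z j + dzero j s)%N.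
  by rewrite /dzero; symmetry; apply: count_add_in => x _; lia.
(* Both sides count the letters of level at most [j] that are positive or decorated, those that are
   both being counted once more on neither side than on the other. *)
have pE j : (plow j s + Z j.+1 = X j + dlow j s)%N.
  rewrite /plow /dlow /Z /X; elim: (s) => //= x t IH.
  move: IH; case: (dec x); rewrite ?andbF ?andbT; lia.
(* This is q^(d_1 + ... + d_j), written as a quotient because the exponent may be negative. The sum
   over [j] telescopes from [T 0 = 1] to [T B = q ^+ N], all levels being below [B]. *)
pose T j : R := q ^+ X j / q ^+ Z j.
have qX i : q ^+ i != 0 by rewrite expf_neq0.
have TS j : omq (upos 1 s) * (q ^+ plow j s * G j s) = (T j - T j.+1) * G 0 s.
  apply: (mulfI (qX (Z j.+1))).
  have -> : q ^+ Z j.+1 * (omq (upos 1 s) * (q ^+ plow j s * G j s)) =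
    q ^+ X j * (omq (upos 1 s) * (q ^+ dlow j s * G j s)).
    by rewrite mulrCA [in RHS]mulrCA; congr (_ * _); rewrite !mulrA -!exprD addnC pE.
  rewrite words_gf_decorated // !mulrA; congr (_ * _).
  rewrite /T XS ZS !exprD; field.
  by rewrite !qX.
rewrite mulr_sumr (eq_bigr (fun j : 'I_B => (T j - T j.+1) * G 0 s)) => [|j _]; last exact: TS.
rewrite -mulr_suml; congr (_ * _).
have -> : \sum_(j < B) (T j - T j.+1) = T 0 - T B.
  by elim: (B) => [|b IHb]; rewrite ?big_ord0 ?subrr // big_ord_recr /= IHb addrA subrK.
have -> : T 0 = 1.
  have -> : T 0 = q ^+ count pred0 s / q ^+ count pred0 s.
    rewrite /T /X /Z; congr (_ ^+ _ / _ ^+ _); apply: eq_in_count => x /s_gt0 /=; lia.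
  by rewrite !count_pred0 expr0 divr1.
congr (_ - _); rewrite /T.
have -> : X B = (Z B + N)%N.
  rewrite /X /Z; have -> : count (fun x => [&& (lev x <= B)%N, (0 < lab x)%N & ~~ dec x]) s =
    count (fun x => (0 < lab x)%N && ~~ dec x) s.
    by apply: eq_in_count => x /sB; clear; lia.
  rewrite UZ; congr (_ + _)%N; apply: eq_in_count => x /sB; clear; lia.
by rewrite exprD mulrAC divff ?mul1r.
Qed.

(** If G_0 is not zero, then z_h <= u_(h+1) for every h > 0. Summing over h bounds r = u_1 by the
    total of the u_h minus that of the z_h, which is [N]. *)
Lemma words_gf0_touching r N s :
  {in s, forall x, (0 < lev x)%N} -> upos 1 s = r ->
  count (fun x => (0 < lab x)%N && ~~ dec x) s
    = (count (fun x => (lab x == 0%N) && dec x) s + N)%N ->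
  (N < r)%N -> G 0 s = 0.
Proof.
move=> s_gt0 ur UZ Nr.
pose X j := count (fun x => [&& (lev x <= j)%N, (0 < lab x)%N & ~~ dec x]) s.
pose Z j := count (fun x => [&& (lev x < j)%N, lab x == 0%N & dec x]) s.
have XS j : X j.+1 = (X j + upos j.+1 s)%N.
  by rewrite /upos; symmetry; apply: count_add_in => x _; lia.
have ZS j : Z j.+1 = (Z j + dzero j s)%N.
  by rewrite /dzero; symmetry; apply: count_add_in => x _; lia.
have [//|G0] := eqVneq (G 0 s) 0.
have uz h : (0 < h)%N -> (dzero h s <= upos h.+1 s)%N.
  by move=> h0; rewrite leqNgt; apply/negP => /(words_gf0_dzero h0)/eqP; rewrite (negbTE G0).
have ZX b : (Z b.+1 + r <= X b.+1)%N.
  elim: b => [|b IHb]; last by rewrite ZS XS; have := uz b.+1 isT; lia.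
  have -> : Z 1 = count pred0 s by apply: eq_in_count => x /s_gt0 /=; lia.
  by rewrite XS ur count_pred0 leq_addl.
pose b := (\max_(x <- s) lev x)%N.
have := ZX b.
have -> : Z b.+1 = count (fun x => (lab x == 0%N) && dec x) s.
  apply: eq_in_count => x xs; have : (lev x <= b)%N by rewrite /b (leq_bigmax_seq x).
  by clear; lia.
have : (X b.+1 <= count (fun x => (0 < lab x)%N && ~~ dec x) s)%N.
  by apply: sub_count => x /= /and3P[_ -> ->].
by rewrite UZ; lia.
Qed.

End Diagonals.

(** * Square paths as words *)

(** Rebuilds a path from its area word, [d] being the current y - x: there are d - x east steps
    before a north step at height x, and d at the end. [admissible] says that these numbers are
    nonnegative, so that [absz] loses nothing. *)
Fixpoint steps_of (d : int) (a : seq int) : seq bool :=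
  if a is x :: a' then nseq (absz (d - x)%R) false ++ true :: steps_of (x + 1) a'
  else nseq (absz d) false.

Fixpoint admissible (d : int) (a : seq int) : bool :=
  if a is x :: a' then (x <= d) && admissible (x + 1) a' else 0 <= d.

Lemma count_steps p : (count id p + count negb p = size p)%N.
Proof. exact: count_predC. Qed.

Lemma area_word_steps p d : d + (count id p)%:Z = (count negb p)%:Z ->
  admissible d (area_word d p) /\ steps_of d (area_word d p) = p.
Proof.
elim: p d => [|[] p IH] d /= bal; first by have -> : d = 0 by lia.
  by have [|-> ->] := IH (d + 1); rewrite ?lexx ?subrr //; lia.
have [|ad st] := IH (d - 1); first by lia.
split; first by case: (area_word _ _) ad => [|x a] /=; lia.
rewrite -[in RHS]st; case: (area_word _ _) ad => [|x a] /= ad.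
  by have -> : absz d = (absz (d - 1)%R).+1 by lia.
by have -> : absz (d - x)%R = (absz (d - 1 - x)%R).+1 by lia.
Qed.

Lemma area_word_nseq k d p : area_word d (nseq k false ++ p) = area_word (d - k%:Z) p.
Proof. by elim: k d => [|k IH] d /=; rewrite ?subr0 // IH; congr area_word; lia. Qed.

Lemma area_word_steps_of a d : admissible d a ->
  [/\ area_word d (steps_of d a) = a, count id (steps_of d a) = size a
    & (count negb (steps_of d a))%:Z = d + (size a)%:Z].
Proof.
elim: a d => [|x a IH] d /=.
  move=> d0; split; last by rewrite count_nseq; lia.
    by rewrite -[nseq _ _]cats0 area_word_nseq.
  by rewrite count_nseq.
case/andP=> xd /IH[aE c1 c2]; rewrite area_word_nseq !count_cat !count_nseq /= c1.
split; [|lia|lia].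
have -> : d - (absz (d - x)%R)%:Z = x by lia.
by rewrite aE.
Qed.

Lemma last_steps_of b d a : admissible d a ->
  last b (steps_of d a) = if a is x :: a' then last x a' < 0 else (d == 0) && b.
Proof.
elim: a b d => [|x a IH] b d /=.
  by case: d => // -[|k] _ //=; elim: k.
move=> /andP[_ ad]; rewrite last_cat /= IH //; case: a ad {IH} => //= ad.
by rewrite andbT; lia.
Qed.

Lemma square_path_admissible N a : size a = N ->
  admissible 0 a -> 0 <= last (-1) a -> square_path N (steps_of 0 a).
Proof.
move=> sa ad la; have [_ c1 c2] := area_word_steps_of ad.
apply/and3P; split; last by rewrite last_steps_of //; case: (a) la => //=; lia.
  by rewrite -count_steps c1; apply/eqP; move: c2; rewrite sa; clear; lia.
by rewrite c1 sa.
Qed.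

Lemma admissible_square_path N p : square_path N p ->
  [/\ size (area_word 0 p) = N, admissible 0 (area_word 0 p),
      0 <= last (-1) (area_word 0 p) & steps_of 0 (area_word 0 p) = p].
Proof.
case/and3P=> /eqP sp /eqP cp lp; have := count_steps p; rewrite sp cp => cn.
have [|ad st] := @area_word_steps p 0; first by rewrite add0r cp; congr (Posz _); move: cn; clear; lia.
have [_ c1 _] := area_word_steps_of ad; split=> //; first by rewrite -c1 st.
move: lp; rewrite -[in last _ p]st last_steps_of //; case: (area_word _ _) => //= x a; lia.
Qed.

Definition rise (p : seq bool) : int := (count id p)%:Z - (count negb p)%:Z.

(** Each low point of a path is the start of a north step or the end of the path, so the area word
    and the end point bound y - x everywhere. *)
Lemma rise_ge_min p d c j : (forall x, x \in area_word d p -> c <= x) ->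
  c <= d + rise p -> c <= d + rise (take j p).
Proof.
rewrite /rise; elim: p d j => [|b p IH] d [|j] /=; try by move=> _; lia.
  case: b => /= ha hc; first by have := ha d (mem_head _ _); lia.
  have := IH (d - 1) 0%N ha; rewrite take0 /=; lia.
case: b => /= ha hc.
  by have := IH (d + 1) j (fun x xa => ha x (mem_behead (s := _ :: _) xa)); lia.
by have := IH (d - 1) j ha; lia.
Qed.

Lemma mem_area_word p d x : x \in area_word d p ->
  exists2 j, (j <= size p)%N & x = d + rise (take j p).
Proof.
rewrite /rise; elim: p d => //= b p IH d; case: b.
  rewrite inE => /orP[/eqP->|/IH[j jp ->]]; first by exists 0%N => //; rewrite take0 /=; lia.
  by exists j.+1 => //=; lia.
by move=> /IH[j jp ->]; exists j.+1 => //=; lia.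
Qed.

Lemma shift_le_size p : (shift p <= size p)%N.
Proof.
apply/bigmax_leqP => i _; apply: leq_trans (leq_subr _ _) _.
by apply: leq_trans (count_size _ _) _; rewrite size_take; case: ifP => // /ltnW.
Qed.

Lemma area_word_ge_shift p x : x \in area_word 0 p -> - (shift p)%:Z <= x.
Proof.
case/mem_area_word => j jp ->.
have := leq_bigmax (F := fun j : 'I_(size p).+1 =>
  (count negb (take j p) - count id (take j p))%N) (Ordinal (jp : (j < (size p).+1)%N)).
by rewrite -/(shift p) /rise /=; lia.
Qed.

Lemma shift_eqP N p (s : nat) : square_path N p ->
  (forall x, x \in area_word 0 p -> - s%:Z <= x) -> - s%:Z \in area_word 0 p -> shift p = s.
Proof.
case/and3P=> /eqP sp /eqP cp _ ge_s mem_s; have := count_steps p; rewrite sp cp => cn.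
apply/eqP; rewrite eqn_leq; apply/andP; split; last first.
  by have := area_word_ge_shift mem_s; lia.
apply/bigmax_leqP => i _; have := @rise_ge_min p 0 (- s%:Z) i ge_s.
have -> : rise p = 0 by rewrite /rise cp; move: cn; clear; lia.
by rewrite /rise; lia.
Qed.

Definition letter_height (j : nat) (x : letter) : int := (lev x)%:Z - j%:Z - 1.

Lemma admissible_nth d a i : admissible d a -> (i < size a)%N ->
  nth 0 a i <= if i is i'.+1 then nth 0 a i' + 1 else d.
Proof.
elim: a d i => // x a IH d [|i] /= /andP[xd ad] //; rewrite ltnS => ia.
by have := IH _ i ad ia; case: i ia.
Qed.

Lemma path_step_admissible j p w : path step p w -> (j <= lev (last p w))%N ->
  admissible (letter_height j p + 1) (map (letter_height j) w).
Proof.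
elim: w p => /= [|x w IH] p; first by rewrite /letter_height; lia.
by case/andP=> px /IH{}IH /IH ->; rewrite andbT; move: px; rewrite /step /letter_height; lia.
Qed.

Section Encoding.
Variables (N l : nat) (P : dlpath N l) (j : nat) (w : seq letter).

Definition encodes : Prop :=
  [/\ area_word 0 (steps P) = map (letter_height j) w, map val P.1.2 = map lab w :> seq nat
    & forall i : 'I_N, (i \in dv P) = dec (nth (start j) w i)].

Hypothesis encP : encodes.
Hypothesis squareP : square_path N (steps P).

Lemma encodes_size : size w = N.
Proof. by case: encP => _ /(congr1 size); rewrite !size_map size_tuple. Qed.

Lemma encodes_height i : (i < N)%N -> height P i = letter_height j (nth (start j) w i).
Proof. by case: encP => E _ _ iN; rewrite /height E (nth_map (start j)) ?encodes_size. Qed.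

Lemma encodes_label i : (i < N)%N -> label P i = lab (nth (start j) w i).
Proof. by case: encP => _ E _ iN; rewrite /label E (nth_map (start j)) ?encodes_size. Qed.

Lemma encodes_card (f : pred letter) :
  #|[set i : 'I_N | f (nth (start j) w i)]| = count f w.
Proof.
rewrite cardsE cardE /enum_mem size_filter -enumT /=.
rewrite -(@count_map _ _ (fun i : 'I_N => nth (start j) w i) f); congr count.
apply: (@eq_from_nth _ (start j)) => [|i]; rewrite size_map size_enum_ord ?encodes_size //.
move=> iN; have i0 := Ordinal iN; rewrite (nth_map i0) ?size_enum_ord //.
by rewrite nth_enum_ord.
Qed.

Lemma encodes_lev_ge0 : pshift P = j -> all (fun x => 0 < lev x)%N w.
Proof.
move=> sj; apply/allP => x xw; have : letter_height j x \in area_word 0 (steps P).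
  by case: encP => -> _ _; apply: map_f.
by move/area_word_ge_shift; rewrite -/(pshift P) sj /letter_height; lia.
Qed.

Lemma encodes_pshift : all (fun x => 0 < lev x)%N w -> (0 < upos 1 w)%N -> pshift P = j.
Proof.
move=> w_gt0; rewrite -has_count => /hasP[x xw /and3P[/eqP x1 _ _]].
case: encP => E _ _; apply: (shift_eqP squareP); rewrite E.
  by move=> _ /mapP[y /(allP w_gt0) y0 ->]; rewrite /letter_height; lia.
by apply/mapP; exists x => //; rewrite /letter_height x1; lia.
Qed.

Lemma encodes_touching : pshift P = j -> touching P = upos 1 w.
Proof.
move=> sj; have w_gt0 := encodes_lev_ge0 sj; rewrite /upos -encodes_card; apply: eq_card => i.
rewrite !inE encodes_height // encodes_label // sj; case: encP => _ _ ->.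
by rewrite /letter_height andbC -andbA; congr (_ && _); apply/eqP/eqP; lia.
Qed.

Lemma encodes_path : path step (start j) w =
  [forall i : 'I_N, (0 < i)%N && (height P i > height P i.-1) ==> (label P i > label P i.-1)%N]
  && [forall i : 'I_N, ((i : nat) == 0%N) && (height P i == 0) ==> (label P i > 0)%N]
  && (dv P \subset [set i | contractible_valley P i]).
Proof.
have [_ ad _ _] := admissible_square_path squareP.
have stepE (i : 'I_N) : step (nth (start j) (start j :: w) i) (nth (start j) w i) =
  [&& (0 < i)%N && (height P i > height P i.-1) ==> (label P i > label P i.-1)%N,
      ((i : nat) == 0%N) && (height P i == 0) ==> (label P i > 0)%N
    & (i \in dv P) ==> contractible_valley P i].
  (* An area word rises by at most one, so the three alternatives of [step] cover every pair of
     consecutive heights; [start j] stands before index 0. *)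
  have iN := ltn_ord i; have : height P i <= if i : nat is i'.+1 then height P i' + 1 else 0.
    by apply: admissible_nth ad _; case: encP => -> _ _; rewrite size_map encodes_size.
  rewrite /contractible_valley; case: encP => _ _ ->.
  case: (i : nat) iN => [|k] kN /=; rewrite !(encodes_height kN) !(encodes_label kN).
    by move: (nth _ w 0%N) => u; rewrite /step /letter_height lev_start lab_start; lia.
  rewrite !(encodes_height (ltnW kN)) !(encodes_label (ltnW kN)).
  by move: (nth _ w k) (nth _ w k.+1) => u v; rewrite /step /letter_height; lia.
apply/(pathP (start j))/andP => [H|[/andP[/forallP H1 /forallP H2] /subsetP H3] i].
  rewrite encodes_size in H; have {}H (i : 'I_N) := H i (ltn_ord i).
  have {}H (i : 'I_N) : _ := etrans (esym (stepE i)) (H i).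
  split; first by apply/andP; split; apply/forallP => i; case/and3P: (H i).
  by apply/subsetP => i iP; rewrite inE; case/and3P: (H i) => _ _ /implyP; apply.
rewrite encodes_size => iN; rewrite -[i]/(val (Ordinal iN)) stepE H1 H2 /=.
by apply/implyP => /H3; rewrite inE.
Qed.

Lemma encodes_valid : valid j w = path step (start j) w.
Proof.
have [sa _ la _] := admissible_square_path squareP.
rewrite /valid; case: path => //=; case: encP la => -> _ _.
rewrite (last_nth 0) (last_nth (start j.+1)) size_map encodes_size.
case: (N) encodes_size => [|k] sw; first by rewrite /= lev_start ltnSn.
rewrite /= (nth_map (start j.+1)) ?sw //.
by move: (nth _ w k) => u; rewrite /letter_height; lia.
Qed.

Definition word_ok (m n k r : nat) : bool :=
  [&& valid j w, all (fun x => 0 < lev x)%N w, upos 1 w == r,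
      count (fun x => lab x == 0%N) w == m, count (fun x => 0 < lab x)%N w == n
    & count dec w == k].

Lemma encodes_ok m n k r : (0 < r)%N ->
  [&& decorated_square_path P m n k, pshift P == j & touching P == r] = word_ok m n k r.
Proof.
move=> r0.
have E0 : #|[set i : 'I_N | label P i == 0%N]| = count (fun x => lab x == 0%N) w.
  by rewrite -encodes_card; apply: eq_card => i; rewrite !inE encodes_label.
have E1 : #|[set i : 'I_N | (label P i > 0)%N]| = count (fun x => lab x > 0)%N w.
  by rewrite -encodes_card; apply: eq_card => i; rewrite !inE encodes_label.
have E2 : #|dv P| = count dec w.
  by rewrite -encodes_card; apply: eq_card => i; rewrite !inE; case: encP.
rewrite /decorated_square_path /word_ok squareP E0 E1 E2 encodes_valid encodes_path /=.
apply/idP/idP.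
  case/andP=> /and5P[/and3P[-> -> _] -> -> -> ->] /andP[/eqP sj /eqP tr].
  by rewrite encodes_lev_ge0 // -(encodes_touching sj) tr eqxx.
case/and3P=> /andP[/andP[pl1 pl2] ->] w_gt0 /and4P[/eqP ur -> -> ->].
have sj := encodes_pshift w_gt0 (eq_ind_r (fun i => 0 < i)%N r0 ur).
rewrite encodes_touching // sj ur !eqxx /= !andbT /partial_labelling pl1 pl2 /=.
(* The last clause of [partial_labelling] asks for a positive label on the lowest diagonal; as [r]
   is positive, a touching point supplies it. *)
have : (0 < touching P)%N by rewrite encodes_touching // ur.
rewrite card_gt0 => /set0Pn[i]; rewrite inE => /and3P[_ hi li].
by apply/existsP; exists i; rewrite hi li.
Qed.
End Encoding.

Lemma count_nth_sum (T : Type) (x0 : T) (a : pred T) (w : seq T) :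
  count a w = (\sum_(i < size w) a (nth x0 w i))%N.
Proof. by rewrite -sum1_count (big_nth x0) big_mkord big_mkcond; apply: eq_bigr => i _; case: (a _). Qed.

Lemma word_inv_sum x0 (w : seq letter) :
  word_inv w = (\sum_(i < size w) \sum_(k < size w)
    [&& i < k, ~~ dec (nth x0 w i) & attacks (nth x0 w i) (nth x0 w k)])%N.
Proof.
elim: w => [|x w IH]; first by rewrite big_ord0.
rewrite [LHS]/= big_ord_recl big_ord_recl /= add0n; congr (_ + _)%N.
  case: (dec x) => /=; first by rewrite big1.
  by rewrite (count_nth_sum x0).
by rewrite IH; apply: eq_bigr => i _; rewrite big_ord_recl.
Qed.

Lemma exprz_split (F : fieldType) (q t : F) (a b c d : nat) : q != 0 ->
  q ^ ((a + b)%:Z - c%:Z) * t ^ d%:Z = q ^+ a * (q ^+ b * (q ^- c * t ^+ d)).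
Proof. by move=> q0; rewrite expfzDr // -exprnN -!exprnP exprD !mulrA. Qed.

Lemma qv_neq0 : qv != 0.
Proof. by rewrite /qv tofrac_eq0 polyC_eq0 polyX_eq0. Qed.

Definition area_sum (w : seq letter) : nat := (\sum_(x <- w) (lev x).-1)%N.

Section EncodedWeight.
Variables (N l : nat) (P : dlpath N l) (j : nat) (w : seq letter).
Hypothesis encP : encodes P j w.
Hypothesis shiftP : pshift P = j.

Let size_w : size w = N := encodes_size encP.
Let heightE (i : 'I_N) : height P i = letter_height j (nth (start j) w i) := encodes_height encP (ltn_ord i).
Let labelE (i : 'I_N) : label P i = lab (nth (start j) w i) := encodes_label encP (ltn_ord i).
Let dvE (i : 'I_N) : (i \in dv P) = dec (nth (start j) w i).
Proof. by case: encP. Qed.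

Lemma card_dv : #|dv P| = count dec w.
Proof. by rewrite -(encodes_card encP); apply: eq_card => i; rewrite inE dvE. Qed.

Lemma encodes_dinv : dinv P = (word_inv w + plow j w)%:Z - (count dec w)%:Z.
Proof.
rewrite /dinv card_dv PoszD; congr (Posz _ + Posz _ - _).
  rewrite -sum1dep_card big_mkcond /= (word_inv_sum (start j)) size_w pair_bigA /=.
  apply: eq_bigr => -[i k] _ /=; rewrite /inversion dvE !heightE !labelE.
  move: (nth _ w i) (nth _ w k) => x y; rewrite /attacks /letter_height; case: ifP; lia.
rewrite /plow -(encodes_card encP); apply: eq_card => i; rewrite !inE heightE labelE.
by move: (nth _ w i) => x; rewrite /letter_height; lia.
Qed.

Lemma encodes_area : all (fun x => 0 < lev x)%N w -> area P = (area_sum w)%:Z.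
Proof.
move=> w_gt0; rewrite /area /area_sum shiftP (big_nth (start j)) big_mkord size_w.
rewrite -[RHS]natz natr_sum; apply: eq_bigr => i _; rewrite natz heightE.
have : (0 < lev (nth (start j) w i))%N by apply: (allP w_gt0); apply: mem_nth; rewrite size_w.
by move: (nth _ w i) => x; rewrite /letter_height; lia.
Qed.

Lemma encodes_weight : all (fun x => 0 < lev x)%N w ->
  weight P = (qv ^+ word_inv w * (qv ^+ plow j w * (qv ^- count dec w * tv ^+ area_sum w)))
             *: monomial P.
Proof.
move=> w_gt0; rewrite /weight encodes_dinv (encodes_area w_gt0).
exact: (congr1 (fun c => c *: monomial P) (exprz_split tv _ _ _ _ qv_neq0)).
Qed.
End EncodedWeight.

Lemma encodes_inj N l (P : dlpath N l) j w1 w2 : encodes P j w1 -> encodes P j w2 -> w1 = w2.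
Proof.
move=> e1 e2; apply: (@eq_from_nth _ (start j)); rewrite (encodes_size e1) ?(encodes_size e2) // => i iN.
have := encodes_height e1 iN; rewrite (encodes_height e2 iN).
have := encodes_label e1 iN; rewrite (encodes_label e2 iN).
case: e1 e2 => _ _ /(_ (Ordinal iN)) /= + [_ _ /(_ (Ordinal iN)) /=].
move=> -> ; case: (nth _ w1 i) (nth _ w2 i) => [[a b] c] [[a' b'] c'].
rewrite /letter_height /lev /lab /dec /= => -> -> aa; congr (_, _, _); lia.
Qed.

(** * Sums over paths as sums over words in a finite alphabet *)

Section Reindexing.
Variables (N l : nat).
Local Notation B := (3 * N).+2.
(** Heights are at most N and shifts at most 2N, the number of steps, so levels are at most 3N +
    1. *)
Definition bounded_letter : finType := ('I_B * 'I_l.+1 * bool)%type.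
Implicit Types (w : N.-tuple bounded_letter) (P : dlpath N l) (j : nat).

Definition to_letter (x : bounded_letter) : letter := (val x.1.1, val x.1.2, x.2).
Local Notation letters w := (map to_letter w).

Lemma to_letter_inj : injective to_letter.
Proof. by move=> [[a b] c] [[a' b'] c'] [] /val_inj -> /val_inj -> ->. Qed.

Lemma size_letters w : size (letters w) = N.
Proof. by rewrite size_map size_tuple. Qed.

Lemma nth_letters x0 w (i : 'I_N) : nth x0 (letters w) i = to_letter (tnth w i).
Proof. by rewrite (nth_map (tnth w i)) ?size_tuple // -tnth_nth. Qed.

Definition path_word j P : N.-tuple bounded_letter :=
  [tuple (inord (absz (height P i + j%:Z + 1)%R), tnth P.1.2 i, i \in dv P) | i < N].

Definition word_path j w : dlpath N l :=
  (insubd (nseq_tuple (N + N) true) (steps_of 0 (map (letter_height j) (letters w))),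
   [tuple (tnth w i).1.2 | i < N], [set i | (tnth w i).2]).

Lemma path_word_encodes P j : square_path N (steps P) -> pshift P = j ->
  encodes P j (letters (path_word j P)).
Proof.
move=> sP sj; have [sa _ _ _] := admissible_square_path sP; split.
- apply: (@eq_from_nth _ 0) => [|i]; first by rewrite sa size_map size_letters.
  rewrite sa => iN.
  rewrite (nth_map (start 0)) ?size_letters // -[i]/(val (Ordinal iN)) nth_letters tnth_mktuple.
  have mi : height P (Ordinal iN) \in area_word 0 (steps P) by apply: mem_nth; rewrite sa.
  have := area_word_ge_shift mi; rewrite -/(pshift P) sj => ge.
  have [t tp letter_height'] := mem_area_word mi.
  have le : height P (Ordinal iN) <= N%:Z.
    rewrite letter_height' /rise; have : (count id (take t (steps P)) <= count id (steps P))%N.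
      by rewrite -[in leqRHS](cat_take_drop t (steps P)) count_cat leq_addr.
    by case/and3P: sP => _ /eqP-> _; lia.
  have jN : (j <= N + N)%N by rewrite -sj; have := shift_le_size (steps P); rewrite size_tuple.
  rewrite -[nth 0 _ _]/(height P (Ordinal iN)) /letter_height /lev; move: ge le jN => /=.
  by move: (height P _) => h ge le jN; rewrite inordK; lia.
- apply: (@eq_from_nth _ 0%N) => [|i]; first by rewrite [LHS]size_map [RHS]size_map size_letters size_tuple.
  rewrite size_map size_tuple => iN.
  rewrite [RHS](nth_map (start 0)) ?size_letters // -[i]/(val (Ordinal iN)).
  by rewrite nth_letters tnth_mktuple (nth_map (tnth P.1.2 (Ordinal iN))) ?size_tuple // -tnth_nth.
by move=> i; rewrite nth_letters tnth_mktuple.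
Qed.

Lemma word_pathK P j : square_path N (steps P) -> pshift P = j ->
  word_path j (path_word j P) = P.
Proof.
move=> sP sj; have [aE _ _] := path_word_encodes sP sj.
have [_ _ _ sE] := admissible_square_path sP.
case: P sP sj aE sE => [[p L] D] sP sj aE sE; congr (_, _, _).
- by apply: val_inj; rewrite insubdK -aE sE ?size_tuple //; apply/eqP; rewrite size_tuple.
- by apply: eq_from_tnth => i; rewrite !tnth_mktuple.
by apply/setP => i; rewrite inE tnth_mktuple.
Qed.

Lemma valid_admissible j v : valid j v -> v != [::] ->
  admissible 0 (map (letter_height j) v) /\ 0 <= last (-1) (map (letter_height j) v).
Proof.
case: v => // x v /andP[vp vl] _; split; last first.
  by rewrite /= last_map; move: vl; rewrite /= /letter_height; lia.
have -> : 0 = letter_height j (start j) + 1 by rewrite /letter_height lev_start; lia.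
by apply: path_step_admissible => //; apply: ltnW; move: vl.
Qed.

Lemma steps_word_path j w : (0 < N)%N -> valid j (letters w) ->
  steps (word_path j w) = steps_of 0 (map (letter_height j) (letters w)) /\
  square_path N (steps_of 0 (map (letter_height j) (letters w))).
Proof.
move=> N0 vw; have [|ad la] := valid_admissible vw.
  by rewrite -size_eq0 size_map size_tuple -lt0n.
have sq : square_path N (steps_of 0 (map (letter_height j) (letters w))).
  by apply: square_path_admissible; rewrite // size_map size_letters.
split=> //; rewrite /steps /= insubdK //.
by case/and3P: sq.
Qed.

Lemma word_path_encodes j w : (0 < N)%N -> valid j (letters w) ->
  encodes (word_path j w) j (letters w).
Proof.
move=> N0 vw; have [sE _] := steps_word_path N0 vw; split.
- rewrite sE; have [|ad _] := valid_admissible vw.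
    by rewrite -size_eq0 size_map size_tuple -lt0n.
  by have [-> _ _] := area_word_steps_of ad.
- apply: (@eq_from_nth _ 0%N) => [|i]; first by rewrite [LHS]size_map [RHS]size_map size_letters size_tuple.
  rewrite size_map size_tuple => iN.
  rewrite [RHS](nth_map (start 0)) ?size_letters // -[i]/(val (Ordinal iN)).
  by rewrite nth_letters (nth_map ord0) ?size_tuple // nth_mktuple.
by move=> i; rewrite inE nth_letters.
Qed.

Lemma word_pathK' j w : (0 < N)%N -> valid j (letters w) -> pshift (word_path j w) = j ->
  path_word j (word_path j w) = w.
Proof.
move=> N0 vw sj; have [sE sq] := steps_word_path N0 vw; rewrite -sE in sq.
apply/val_inj/(inj_map to_letter_inj).
exact: encodes_inj (path_word_encodes sq sj) (word_path_encodes N0 vw).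
Qed.

Definition label_monomial (x : bounded_letter) : {malg Qqt['X_{1..l}]} :=
  if unlift ord0 x.1.2 is Some i then << ucm i >> else 1.

Definition content_weight (v : seq bounded_letter) : {malg Qqt['X_{1..l}]} :=
  (qv ^- count dec (letters v) * tv ^+ area_sum (letters v)) *: \prod_(x <- v) label_monomial x.

Lemma sum_paths_words (j m n k r : nat) : (0 < N)%N -> (0 < r)%N ->
  \sum_(P : dlpath N l | [&& decorated_square_path P m n k, pshift P == j & touching P == r]) weight P
  = \sum_(w : N.-tuple bounded_letter | word_ok j (letters w) m n k r)
      (qv ^+ word_inv (letters w) * qv ^+ plow j (letters w)) *: content_weight w.
Proof.
move=> N0 r0; rewrite (reindex_onto (word_path j) (path_word j)); last first.
  by move=> P /and3P[/and3P[sP _ _] /eqP sj _]; apply: word_pathK.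
apply: eq_big => [w|w].
  apply/andP/idP => [[ok /eqP wE]|ok].
    have /and3P[/and3P[sP _ _] /eqP sj _] := ok.
    have := path_word_encodes sP sj; rewrite wE => enc.
    by rewrite -(encodes_ok enc sP).
  have vw : valid j (letters w) by case/and3P: ok.
  have enc := word_path_encodes N0 vw; have [sE sP] := steps_word_path N0 vw; rewrite -sE in sP.
  rewrite -(encodes_ok enc sP) // in ok; split=> //.
  by apply/eqP/word_pathK' => //; case/and3P: ok => _ /eqP.
case/andP=> /[dup] ok /and3P[/and3P[sP _ _] /eqP sj _] /eqP wE.
have := path_word_encodes sP sj; rewrite wE => enc.
have /and3P[_ w_gt0 _] : word_ok j (letters w) m n k r by rewrite -(encodes_ok enc sP).
rewrite (encodes_weight enc sj w_gt0) /content_weight scalerA !mulrA; congr (_ *: _).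
rewrite /monomial [RHS]big_tuple; apply: eq_bigr => i _; congr (if unlift ord0 _ is Some i then _ else _).
by rewrite tnth_mktuple.
Qed.
End Reindexing.

(** * Summation over all contents *)

(** The multiplicity function [c] partitions the words into rearrangement classes, on each of which
    the two sums agree. *)
Lemma eq_sum_by_content (T : finType) (N : nat) (V : nmodType) (F G : N.-tuple T -> V) :
  (forall s : N.-tuple T, \sum_(w : N.-tuple T | perm_eq w s) F w
                        = \sum_(w : N.-tuple T | perm_eq w s) G w) ->
  \sum_w F w = \sum_w G w.
Proof.
move=> FG; pose c (w : N.-tuple T) : {ffun T -> 'I_N.+1} := [ffun x => inord (count_mem x w)].
have cE w s : (c w == c s) = perm_eq w s.
  have cK w' x : (c w' x : nat) = count_mem x w'.
    by rewrite ffunE inordK // ltnS -[in leqRHS](size_tuple w') count_size.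
  apply/eqP/idP => [cws|ws]; last by apply/ffunP => x; rewrite !ffunE (permP ws).
  by apply/allP => x _ /=; rewrite -!cK cws.
rewrite (partition_big c xpredT) // [RHS](partition_big c xpredT) //.
apply: eq_bigr => f _ /=; have [/existsP[s /eqP <-]|/existsPn nf] := boolP [exists s, c s == f].
  by rewrite !(eq_bigl _ _ (fun w => cE w s)).
by rewrite !big_pred0 // => w; apply/negbTE.
Qed.

Lemma map_preimage (S T : eqType) (f : S -> T) (v : seq T) :
  (forall x, x \in v -> exists y, x = f y) -> exists v', v = map f v'.
Proof.
elim: v => [|x v IH] vf; first by exists [::].
have [y ->] := vf x (mem_head _ _); have [|v' ->] := IH; last by exists (y :: v').
by move=> z zv; apply: vf; rewrite inE zv orbT.
Qed.

Lemma sum_tuples_permutations (S : finType) (T : eqType) (V : nmodType) (N : nat)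
    (f : S -> T) (F : seq T -> V) (s : N.-tuple S) : injective f ->
  \sum_(w : N.-tuple S | perm_eq w s) F (map f w) = \sum_(v <- permutations (map f s)) F v.
Proof.
move=> f_inj.
transitivity (\sum_(w <- enum (fun w : N.-tuple S => perm_eq w s)) F (map f w)).
  by rewrite big_enum.
rewrite -(big_map (fun w : N.-tuple S => map f w) predT F); apply: perm_big.
apply: uniq_perm; rewrite ?permutations_uniq //.
  by rewrite map_inj_uniq ?enum_uniq // => w w' /(inj_map f_inj)/val_inj.
move=> v; rewrite mem_permutations; apply/mapP/idP => [[w + ->]|vs].
  by rewrite mem_enum => ws; apply: perm_map.
have [x|v' vE] := @map_preimage _ _ f v.
  by rewrite (perm_mem vs) => /mapP[y _ ->]; exists y.
have v's : perm_eq v' s by move: vs; rewrite vE; apply: perm_map_inj.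
have sv' : size v' == N by rewrite (perm_size v's) size_tuple.
by exists (Tuple sv'); rewrite ?mem_enum.
Qed.

Section ContentSums.
Variables (K : fieldType) (q : K) (V : lmodType K).
Hypotheses (q_neq0 : q != 0) (q_gen : forall i, q ^+ i.+1 != 1).
Variables (S : finType) (f : S -> letter) (B : nat).
Hypotheses (f_inj : injective f) (f_lt : forall x, (lev (f x) < B)%N).
Variables (N m n k r : nat) (cw : seq S -> V).
Hypotheses (cw_perm : forall v v', perm_eq v v' -> cw v = cw v').
Hypotheses (r_gt0 : (0 < r)%N) (le_kn : (k <= n)%N).
Local Notation letters w := (map f w).

Definition word_sum (j : nat) : V :=
  \sum_(w : N.-tuple S | word_ok j (letters w) m n k r)
    (q ^+ word_inv (letters w) * q ^+ plow j (letters w)) *: cw w.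

Definition content_ok (v : seq letter) : bool :=
  [&& all (fun x => 0 < lev x)%N v, upos 1 v == r,
      count (fun x => lab x == 0%N) v == m, count (fun x => 0 < lab x)%N v == n
    & count dec v == k].

Lemma perm_content_ok v v' : perm_eq v v' -> content_ok v = content_ok v'.
Proof. by move=> vv'; rewrite /content_ok /upos (perm_all _ vv') !(permP vv'). Qed.

Lemma word_sumE j :
  word_sum j = \sum_(w : N.-tuple S)
    (if content_ok (letters w) && valid j (letters w)
     then (q ^+ word_inv (letters w) * q ^+ plow j (letters w)) *: cw w else 0).
Proof.
rewrite /word_sum big_mkcond; apply: eq_bigr => w _.
by rewrite /word_ok andbC.
Qed.

Lemma word_sum_content j (s : N.-tuple S) :
  \sum_(w : N.-tuple S | perm_eq w s)
    (if content_ok (letters w) && valid j (letters w)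
     then (q ^+ word_inv (letters w) * q ^+ plow j (letters w)) *: cw w else 0)
  = if content_ok (letters s)
    then (q ^+ plow j (letters s) * words_gf q j (letters s)) *: cw s else 0.
Proof.
case: ifP => os; last first.
  by rewrite big1 // => w ws; rewrite (perm_content_ok (perm_map f ws)) os.
pose F v := if valid j v then q ^+ word_inv v else 0.
transitivity (\sum_(w : N.-tuple S | perm_eq w s)
  (q ^+ plow j (letters s) * F (letters w)) *: cw s).
  apply: eq_bigr => w ws; have lws := perm_map f ws.
  rewrite (perm_content_ok lws) os (cw_perm ws) /plow (permP lws) /F.
  by rewrite /=; case: ifP => _; rewrite ?mulr0 ?scale0r // [in RHS]mulrC.
rewrite -scaler_suml -mulr_sumr (sum_tuples_permutations _ _ f_inj).
by rewrite /words_gf [in RHS]big_mkcond.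
Qed.

Lemma content_ok_count v : content_ok v ->
  count (fun x => (0 < lab x)%N && ~~ dec x) v
    = (count (fun x => (lab x == 0%N) && dec x) v + (n - k))%N.
Proof.
case/and5P=> _ _ _ /eqP cn /eqP ck.
have : (count (fun x => (0 < lab x)%N && ~~ dec x) v + k
  = count (fun x => (lab x == 0%N) && dec x) v + n)%N.
  rewrite -cn -ck; elim: (v) => //= x t; case: (dec x); rewrite ?andbT ?andbF /=; lia.
by move: le_kn; clear; lia.
Qed.

(** After exchanging the sums over shifts and words, it suffices to compare the words of one
    content, on which [plow] and [cw] are constant; there the claim is [sum_words_gf]. For shift 0,
    [plow] is 0 since levels are positive. *)
Lemma word_sum_shift :
  (1 - q ^+ r) *: (\sum_(j < B) word_sum j) = (1 - q ^+ (n - k)) *: word_sum 0.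
Proof.
under eq_bigr do rewrite word_sumE.
rewrite exchange_big scaler_sumr word_sumE scaler_sumr.
apply: eq_sum_by_content => s; rewrite -!scaler_sumr word_sum_content exchange_big /=.
under eq_bigr do rewrite word_sum_content.
case: ifP => os; last by rewrite big1_eq !scaler0.
rewrite -scaler_suml !scalerA; congr (_ *: _).
have /and5P[s_gt0 /eqP ur _ _ _] := os.
rewrite (@sum_words_gf _ _ q_gen B r (n - k)) ?q_neq0 ?content_ok_count //.
  rewrite /plow (@eq_in_count _ _ pred0) ?count_pred0 ?expr0 ?mul1r // => x xs /=.
  by have := allP s_gt0 x xs; clear; lia.
by move=> x /[dup] /(allP s_gt0)-> /mapP[y _ ->]; apply: f_lt.
Qed.

Lemma word_sum_touching : (n - k < r)%N -> word_sum 0 = 0.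
Proof.
move=> nk; rewrite word_sumE; transitivity (\sum_(w : N.-tuple S) (0 : V)); last exact: big1_eq.
apply: eq_sum_by_content => s.
rewrite word_sum_content big1_eq; case: ifP => // os.
have /and5P[s_gt0 /eqP ur _ _ _] := os.
rewrite (@words_gf0_touching _ _ q_gen r (n - k)) ?content_ok_count ?mulr0 ?scale0r //.
exact/allP.
Qed.
End ContentSums.

Lemma qv_generic n : qv ^+ n.+1 != 1.
Proof.
rewrite /qv -rmorphXn /= -tofrac1 tofrac_eq -polyC_exp -polyC1 (inj_eq (@polyC_inj _)).
by apply/eqP => /(congr1 (fun p : {poly rat} => size p)); rewrite size_polyXn size_poly1.
Qed.

Section PathSums.
Variables (N l m n k r : nat).
Hypotheses (N_gt0 : (0 < N)%N) (r_gt0 : (0 < r)%N) (le_kn : (k <= n)%N).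
Local Notation B := (3 * N).+2.

Definition path_sum (j : nat) : {malg Qqt['X_{1..l}]} :=
  \sum_(P : dlpath N l | [&& decorated_square_path P m n k, pshift P == j & touching P == r]) weight P.

Lemma perm_content_weight (v v' : seq (bounded_letter N l)) :
  perm_eq v v' -> content_weight v = content_weight v'.
Proof.
move=> vv'; have lv := perm_map (@to_letter N l) vv'.
by rewrite /content_weight (permP lv) /area_sum (perm_big _ lv) (perm_big _ vv').
Qed.

Lemma path_sumE j :
  path_sum j = word_sum qv (@to_letter N l) N m n k r (@content_weight N l) j.
Proof. exact: sum_paths_words. Qed.

Lemma to_letter_lt (x : bounded_letter N l) : (lev (to_letter x) < B)%N.
Proof. exact: ltn_ord. Qed.

Theorem path_sum_shift :
  (1 - qv ^+ r) *: (\sum_(j < B) path_sum j) = (1 - qv ^+ (n - k)) *: path_sum 0.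
Proof.
under eq_bigr do rewrite path_sumE.
rewrite path_sumE.
exact: (word_sum_shift qv_neq0 qv_generic (@to_letter_inj N l) to_letter_lt _ _ perm_content_weight).
Qed.

Theorem path_sum_touching : (n - k < r)%N -> path_sum 0 = 0.
Proof.
move=> nk; rewrite path_sumE.
exact: (word_sum_touching qv_neq0 qv_generic (@to_letter_inj N l) N m (@perm_content_weight) r_gt0 le_kn nk).
Qed.
End PathSums.

(** * The expansion of omega p_n in the E_{n,r} *)

Definition monomial_eval (S : comNzRingType) (A : nat -> S) (m : {cmonom nat}) : S :=
  \prod_(i <- finsupp (val m)) A i.+1 ^+ m i.

Lemma monomial_eval_mmorphism (S : comNzRingType) (A : nat -> S) : mmorphism (monomial_eval A).
Proof.
have evalEw (d : {fset nat}) m : (finsupp (val m) `<=` d)%fset ->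
  monomial_eval A m = \prod_(i <- d) A i.+1 ^+ m i.
  move=> le; rewrite /monomial_eval (big_fset_incl _ le) // => i _.
  by rewrite -cmE_eq0 => /eqP->; rewrite expr0.
split=> [m1 m2|]; last by rewrite /monomial_eval mdom1 big_seq_fset0.
rewrite {1}/monomial_eval [finsupp _]mdomD.
rewrite (evalEw _ _ (fsubsetUl (finsupp m1) (finsupp m2))).
rewrite (evalEw _ _ (fsubsetUr (finsupp m1) (finsupp m2))) -big_split /=.
by apply: eq_bigr => i _; rewrite cmM exprD.
Qed.

HB.instance Definition _ (S : comNzRingType) (A : nat -> S) :=
  monalg.isMultiplicative.Build {cmonom nat} S (@monomial_eval S A) (monomial_eval_mmorphism A).

Section Pleth.
Variables (S : comNzRingType) (iota : {rmorphism Qqt -> S}) (A : nat -> S).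

Definition plethM (f : Sym) : S := mmap iota (monomial_eval A) f.

Lemma plethE : pleth iota A =1 plethM. Proof. by []. Qed.

Lemma pleth_sum (I : Type) (r : seq I) (P : pred I) (F : I -> Sym) :
  pleth iota A (\sum_(i <- r | P i) F i) = \sum_(i <- r | P i) pleth iota A (F i).
Proof. exact: (raddf_sum (mmap iota (monomial_eval A))). Qed.

Lemma plethZ c f : pleth iota A (c *: f) = iota c * pleth iota A f.
Proof. exact: (mmapZ (h := monomial_eval A)). Qed.

Lemma pleth_prodX (I : Type) (r : seq I) (F : I -> Sym) (m : I -> nat) :
  pleth iota A (\prod_(i <- r) F i ^+ m i) = \prod_(i <- r) pleth iota A (F i) ^+ m i.
Proof.
rewrite plethE /plethM (rmorph_prod (mmap iota (monomial_eval A))).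
by apply: eq_bigr => i _; rewrite (rmorphXn (mmap iota (monomial_eval A))).
Qed.

Lemma pleth_psum k : pleth iota A (psum k.+1) = A k.+1.
Proof.
rewrite plethE /plethM /psum mmapU /= rmorph1 mul1r /monomial_eval.
by rewrite [finsupp _]mdomU big_seq_fset1 cmUU expr1.
Qed.

Lemma pleth_signM b (f : Sym) : pleth iota A ((-1) ^+ b * f) = (-1) ^+ b * pleth iota A f.
Proof.
rewrite plethE /plethM (rmorphM (mmap iota (monomial_eval A))).
by rewrite (rmorphXn (mmap iota (monomial_eval A))) (rmorphN1 (mmap iota (monomial_eval A))).
Qed.
End Pleth.

Lemma omega_psum k : omega (psum k.+1) = (-1) ^+ k * psum k.+1.
Proof. exact: pleth_psum. Qed.

Lemma sym_eE n : sym_e n =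
  \sum_(m : {ffun 'I_n -> 'I_n.+1} | (\sum_(i < n) i.+1 * m i)%N == n)
     ((\prod_(i < n) (i.+1 ^ m i * (m i)`!))%N%:R^-1 : Qqt)
       *: \prod_(i < n) ((-1) ^+ i * psum i.+1) ^+ m i.
Proof.
rewrite /sym_e /sym_h /omega /plethSym (pleth_sum (in_alg Sym)); apply: eq_bigr => m _.
rewrite (plethZ (in_alg Sym)) [LHS]mulr_algl (pleth_prodX (in_alg Sym)).
apply: (congr1 (fun p : Sym => _ *: p)).
apply: eq_bigr => i _.
rewrite (pleth_psum (in_alg Sym)).
reflexivity.
Qed.

Lemma pleth_sym_e (S : comNzRingType) (iota : {rmorphism Qqt -> S}) (A : nat -> S) n :
  pleth iota A (sym_e n) =
  \sum_(m : {ffun 'I_n -> 'I_n.+1} | (\sum_(i < n) i.+1 * m i)%N == n)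
     iota (\prod_(i < n) (i.+1 ^ m i * (m i)`!))%N%:R^-1 *
     \prod_(i < n) ((-1) ^+ i * A i.+1) ^+ m i.
Proof.
rewrite sym_eE pleth_sum; apply: eq_bigr => m _; rewrite plethZ pleth_prodX.
by congr (_ * _); apply: eq_bigr => i _; rewrite pleth_signM pleth_psum.
Qed.

(** Differentiating at 1 plays the part of dividing by 1 - z and setting z = 1: a zero of order at
    least two leaves nothing. *)
Lemma deriv1_expM (S : comNzRingType) (f : {poly S}) k : (0 < k)%N ->
  (((1 - 'X) ^+ k * f)^`()).[1] = if k == 1%N then - f.[1] else 0.
Proof.
case: k => [//|k] _; rewrite eqSS exprS -mulrA derivM !derivE !hornerE subrr mul0r addr0.
by rewrite expr0n /=; case: k => [|k] /=; rewrite ?mulr1 ?mulr0 ?mul0r ?mulN1r.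
Qed.

Lemma qpoch_deriv1 (S : comNzRingType) (Q : S) k :
  ((qpoch 'X Q%:P k.+1)^`()).[1] = - qpoch Q Q k.
Proof.
have -> : qpoch 'X Q%:P k.+1 = (1 - 'X) ^+ 1 * \prod_(i < k) (1 - 'X * Q%:P ^+ i.+1).
  by rewrite /qpoch big_ord_recl expr0 mulr1 expr1.
rewrite deriv1_expM //= horner_prod; congr (- _); apply: eq_bigr => i _.
by rewrite -polyC_exp !hornerE exprS.
Qed.

(** Each 1 - z^(i+1) is 1 - z times a geometric sum, so the order of the zero at 1 is at least the
    number of parts, and only one-part partitions contribute. *)
Lemma deriv1_power_product (S : comNzRingType) n (c : nat -> S) (m : 'I_n -> nat) :
  (0 < \sum_(i < n) m i)%N ->
  ((\prod_(i < n) ((-1) ^+ i * ((c i.+1)%:P * (1 - 'X^(i.+1)))) ^+ m i)^`()).[1]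
  = if (\sum_(i < n) m i)%N == 1%N
    then - \prod_(i < n) ((-1) ^+ i * (c i.+1 * i.+1%:R)) ^+ m i else 0.
Proof.
move=> m_gt0; pose h (i : nat) : {poly S} := (-1) ^+ i * ((c i.+1)%:P * \sum_(j < i.+1) 'X^j).
have -> : \prod_(i < n) ((-1) ^+ i * ((c i.+1)%:P * (1 - 'X^(i.+1)))) ^+ m i
  = (1 - 'X) ^+ (\sum_(i < n) m i) * \prod_(i < n) h i ^+ m i.
  rewrite -prodrXr -big_split /=; apply: eq_bigr => i _; rewrite -exprMn; congr (_ ^+ _).
  rewrite /h -[1 - 'X^_]opprB subrX1 -mulNr opprB.
  by rewrite [in RHS]mulrCA; congr (_ * _); rewrite mulrCA.
rewrite deriv1_expM //; case: ifP => // _; congr (- _); rewrite horner_prod.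
apply: eq_bigr => i _; rewrite horner_exp /h; congr (_ ^+ _).
rewrite hornerM horner_exp hornerN hornerC hornerM hornerC; congr (_ * (_ * _)).
rewrite horner_sum (eq_bigr (fun=> 1)) => [|j _]; last by rewrite hornerXn expr1n.
by rewrite sumr_const card_ord.
Qed.

(* Keeps unification from unfolding the fraction field. *)
Opaque Qqt.

Lemma Qqt_natr_neq0 n : (n.+1%:R : Qqt) != 0.
Proof.
have -> : (n.+1%:R : Qqt) = tofrac (n.+1%:R%:P%:P : {poly {poly rat}}).
  by rewrite !rmorph_nat.
by rewrite tofrac_eq0 !polyC_eq0 pnatr_eq0.
Qed.

Lemma one_part_multiplicities n (m : {ffun 'I_n.+1 -> 'I_n.+2}) :
  ((\sum_(i < n.+1) i.+1 * m i)%N == n.+1) && ((\sum_(i < n.+1) m i)%N == 1%N)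
  = (m == [ffun i => if i == ord_max then 1 else 0]).
Proof.
apply/andP/eqP => [[/eqP w1 s1]|->].
  have [i0 [_ mi0 mi]] := sum_nat_eq1 _ _ s1.
  have i0max : i0 = ord_max.
    apply: val_inj; move: w1; rewrite (bigD1 i0) //= mi0 muln1 big1 ?addn0 => [|i ne].
      by case.
    by rewrite mi ?muln0.
  apply/ffunP => i; apply: val_inj; rewrite ffunE -i0max; case: eqP => [->|/eqP ne] //=.
  by rewrite mi.
have m0 i : i != ord_max -> [ffun i : 'I_n.+1 => if i == ord_max then 1 else 0 : 'I_n.+2] i = 0 :> nat.
  by move=> /negbTE ne; rewrite ffunE ne.
split; rewrite (bigD1 ord_max) //= ffunE eqxx big1 ?muln1 ?addn0 // => i /m0 -> //.
exact: muln0.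
Qed.

Lemma one_partE n i :
  ([ffun i : 'I_n.+1 => if i == ord_max then 1 else 0 : 'I_n.+2] i : nat) = (i == ord_max).
Proof. by rewrite ffunE; case: eqP. Qed.

Lemma prod_one_part (S : comNzRingType) n (f : 'I_n.+1 -> S) :
  \prod_(i < n.+1) f i ^+ [ffun i : 'I_n.+1 => if i == ord_max then 1 else 0 : 'I_n.+2] i
  = f ord_max.
Proof.
rewrite (bigD1 ord_max) //= one_partE eqxx expr1 big1 ?mulr1 // => i /negbTE ne.
by rewrite one_partE ne expr0.
Qed.

Lemma prodn_one_part n (m := [ffun i : 'I_n.+1 => if i == ord_max then 1 else 0 : 'I_n.+2]) :
  (\prod_(i < n.+1) (i.+1 ^ m i * (m i)`!))%N = n.+1.
Proof.
rewrite (bigD1 ord_max) //= one_partE eqxx expn1 muln1 big1 ?muln1 // => i /negbTE ne.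
by rewrite one_partE ne.
Qed.

Lemma natr_inv_scale (K : fieldType) (A : lalgType K) (x y : A) n : (n%:R : K) != 0 ->
  n%:R^-1 *: (x * (y * n%:R)) = x * y.
Proof. by move=> n0; rewrite mulrA mulr_natr -scaler_nat scalerA mulVf ?scale1r. Qed.

(* The identity defining the E_{n,k}, divided by 1 - z and evaluated at z = 1:
   on the left only the term of e_n in p_n survives. *)
Lemma pleth_sym_e_deriv1 n (c : nat -> Sym) :
  ((pleth (fun a : Qqt => (a%:A : Sym)%:P)
      (fun k => (c k)%:P * (1 - 'X^k)) (sym_e n.+1))^`()).[1]
  = - ((-1) ^+ n * c n.+1).
Proof.
rewrite (pleth_sym_e (polyC \o in_alg Sym)) raddf_sum horner_sum /=.
pose z (m : {ffun 'I_n.+1 -> 'I_n.+2}) : Qqt := (\prod_(i < n.+1) (i.+1 ^ m i * (m i)`!))%N%:R^-1.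
have termE (m : {ffun 'I_n.+1 -> 'I_n.+2}) : (\sum_(i < n.+1) i.+1 * m i)%N == n.+1 ->
  ((((z m)%:A : Sym)%:P *
    \prod_(i < n.+1) ((-1) ^+ i * ((c i.+1)%:P * (1 - 'X^(i.+1)))) ^+ m i)^`()).[1] =
  if (\sum_(i < n.+1) m i)%N == 1%N then
    - (z m *: \prod_(i < n.+1) ((-1) ^+ i * (c i.+1 * i.+1%:R)) ^+ m i) else 0.
  move=> /eqP wm; rewrite mul_polyC derivZ hornerZ deriv1_power_product.
    case: ifP => _; last by rewrite mulr0.
    by rewrite mulrN -scalerAl mul1r.
  rewrite lt0n sum_nat_eq0; apply/negP => /forallP m0; move: wm; rewrite big1 // => i _.
  by rewrite (eqP (m0 i)) muln0.
rewrite (eq_bigr _ termE) -big_mkcondr.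
rewrite (big_pred1 [ffun i => if i == ord_max then 1 else 0]); last exact: one_part_multiplicities.
rewrite prod_one_part [z _](_ : _ = n.+1%:R^-1); last by rewrite /z prodn_one_part.
by rewrite natr_inv_scale ?Qqt_natr_neq0.
Qed.

Lemma qpoch_sum_deriv1 (S : comNzRingType) (Q : S) (F : nat -> S) n :
  ((\sum_(k < n.+1) qpoch 'X Q%:P k * (F k)%:P)^`()).[1]
  = - \sum_(k < n) qpoch Q Q k * F k.+1.
Proof.
rewrite raddf_sum horner_sum big_ord_recl /= -sumrN.
rewrite [X in X + _](_ : _ = 0) ?add0r; last first.
  by rewrite /qpoch big_ord0 mul1r derivC horner0.
apply: eq_bigr => k _; rewrite derivM derivC mulr0 addr0 hornerM hornerC.
by rewrite qpoch_deriv1 mulNr.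
Qed.

Lemma qpoch_ratio (K : fieldType) (A : comAlgType K) (q : K) (x : A) k :
  (forall i, q ^+ i.+1 != 1) ->
  qpoch (q%:A : A) q%:A k * ((qpoch q q k.+1)^-1 *: x) = (1 - q ^+ k.+1)^-1 *: x.
Proof.
move=> q_gen; have -> : qpoch (q%:A : A) q%:A k = (qpoch q q k)%:A.
  rewrite -[RHS]/(in_alg A (qpoch q q k)) /qpoch rmorph_prod; apply: eq_bigr => i _.
  by rewrite rmorphB rmorph1 rmorphM rmorphXn.
have qk0 : qpoch q q k != 0.
  by apply/prodf_neq0 => i _; rewrite -exprS subr_eq0 eq_sym.
rewrite mulr_algl scalerA; congr (_ *: _).
by rewrite {2}/qpoch big_ord_recr /= -/(qpoch q q k) -exprS invfM mulrA mulfV ?mul1r.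
Qed.

Lemma scale_sum_inv (K : fieldType) (A : algType K) (I : finType) (d : K) (e : I -> K)
    (s p : A) (x : I -> A) : d != 0 ->
  s * (d^-1 *: p) = \sum_i (e i)^-1 *: x i -> s * p = \sum_i (d / e i) *: x i.
Proof.
move=> d0 E; transitivity (d *: (s * (d^-1 *: p))).
  by rewrite -scalerAr scalerA mulfV ?scale1r.
by rewrite E scaler_sumr; apply: eq_bigr => i _; rewrite scalerA.
Qed.

(** The derivatives at z = 1 of the two sides of the defining identity are compared; the term of
    E_(n+1,0) is constant in z and drops out. *)
Theorem omega_psum_E (E : nat -> nat -> Sym) : is_Enk E -> forall n,
  omega (psum n.+1) =
  \sum_(r < n.+1) ((1 - qv ^+ n.+1) / (1 - qv ^+ r.+1)) *: E n.+1 r.+1.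
Proof.
move=> hE n; rewrite omega_psum; apply: scale_sum_inv.
  by rewrite subr_eq0 eq_sym qv_generic.
have /eqP := congr1 (fun p : {poly Sym} => (p^`()).[1]) (hE n.+1).
rewrite (pleth_sym_e_deriv1 n (fun k => (1 - qv ^+ k)^-1 *: psum k)).
rewrite (qpoch_sum_deriv1 _ (fun k => (qpoch qv qv k)^-1 *: E n.+1 k)) eqr_opp => /eqP ->.
by apply: eq_bigr => r _; apply: qpoch_ratio qv_generic.
Qed.

(** * From touching Dyck paths to square paths *)

(** Linearity for bare functions, in the form in which the expansion of omega(p_N) uses it; it
    passes through the composites of [Delta], [Theta], [nabla] and [in_vars]. *)
Definition preserves_lincomb (K : fieldType) (V W : lmodType K) (f : V -> W) : Prop :=
  forall (n : nat) (c : 'I_n -> K) (x : 'I_n -> V),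
    f (\sum_(i < n) c i *: x i) = \sum_(i < n) c i *: f (x i).

Lemma linear_preserves_lincomb (K : fieldType) (V W : lmodType K) (f : {linear V -> W}) :
  preserves_lincomb f.
Proof. by move=> n c x; rewrite linear_sum; apply: eq_bigr => i _; rewrite linearZ. Qed.

Lemma comp_preserves_lincomb (K : fieldType) (U V W : lmodType K) (f : V -> W) (g : U -> V) :
  preserves_lincomb f -> preserves_lincomb g -> preserves_lincomb (fun x => f (g x)).
Proof. by move=> fP gP n c x; rewrite gP fP. Qed.

Lemma mul_preserves_lincomb (K : fieldType) (A : algType K) (a : A) :
  preserves_lincomb (fun x : A => a * x).
Proof. by move=> n c x; rewrite mulr_sumr; apply: eq_bigr => i _; rewrite scalerAr. Qed.

Lemma pleth_preserves_lincomb (A : comAlgType Qqt) (a : nat -> A) :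
  preserves_lincomb (pleth (in_alg A) a : Sym -> A).
Proof.
move=> n c x; rewrite (pleth_sum (in_alg A)); apply: eq_bigr => i _.
by rewrite (plethZ (in_alg A)) [LHS]mulr_algl.
Qed.

Lemma Theta_preserves_lincomb (diag : (seq nat -> Qqt) -> {linear Sym -> Sym}) (f : Sym) :
  preserves_lincomb (Theta diag f : Sym -> Sym).
Proof.
apply: (comp_preserves_lincomb (f := PiOp diag)); first exact: linear_preserves_lincomb.
apply: (comp_preserves_lincomb (mul_preserves_lincomb _)).
exact: linear_preserves_lincomb.
Qed.

Lemma scale_eq_div (K : fieldType) (V : lmodType K) (a b : K) (x y : V) :
  a != 0 -> a *: x = b *: y -> x = (b / a) *: y.
Proof. by move=> a0 E; rewrite mulrC -scalerA -E scalerA mulVf ?scale1r. Qed.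

Lemma touching_le N l (P : dlpath N l) : (touching P <= N)%N.
Proof. by rewrite -[leqRHS](card_ord N) max_card. Qed.

Lemma pshift_lt N l (P : dlpath N l) : (pshift P < (3 * N).+2)%N.
Proof. by have := shift_le_size (steps P); rewrite size_tuple /pshift; clear; lia. Qed.

Lemma LSQ'_sum_split m n k l :
  LSQ'_sum m n k l = \sum_(r < m + n) \sum_(j < (3 * (m + n)).+2) path_sum (m + n) l m n k r.+1 j.
Proof.
rewrite /LSQ'_sum; set N := (m + n)%N.
rewrite (partition_big (fun P : dlpath N l => inord (touching P) : 'I_N.+1) predT) //=.
(* The class without touching points is empty by definition of [in_LSQ'], so the classes are
   numbered from [r.+1 = 1]. *)
rewrite big_ord_recl big1 ?add0r => [|P]; last first.
  by case/andP=> /andP[_ t0] /eqP/(congr1 val); rewrite /= inordK ?ltnS ?touching_le // => t1; rewrite t1 in t0.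
apply: eq_bigr => r _.
rewrite (partition_big (fun P : dlpath N l => inord (pshift P) : 'I_((3 * N).+2)) predT) //=.
apply: eq_bigr => j _; apply: eq_bigl => P.
rewrite /in_LSQ' -!(inj_eq val_inj) /= !inordK ?ltnS ?touching_le ?pshift_lt // /bump /= ?add1n.
  by case: (touching P =P r.+1) => [->|_]; rewrite ?andbT ?andbF.
exact: pshift_lt.
Qed.

(** The map [f] is left abstract to serve both halves of the theorem, with and without [Delta]. *)
Lemma square_of_touching (E : nat -> nat -> Sym) (hE : is_Enk E) (m n k l : nat)
    (f : Sym -> {malg Qqt['X_{1..l}]}) :
  (k < n)%N -> preserves_lincomb f ->
  (forall r, (r <= n - k)%N -> f (E (n - k)%N r) = LD_sum m n r k l) ->
  f (omega (psum (n - k))) = LSQ'_sum m n k l.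
Proof.
move=> kn f_lin hf.
have [d dE] : exists d, (n - k = d.+1)%N by exists (n - k).-1; rewrite prednK // subn_gt0.
rewrite dE in hf *; rewrite (omega_psum_E hE) f_lin.
have N0 : (0 < m + n)%N by rewrite addn_gt0 (leq_ltn_trans _ kn) ?orbT.
have kn' := ltnW kn.
have shiftE r : \sum_(j < (3 * (m + n)).+2) path_sum (m + n) l m n k r.+1 j =
  ((1 - qv ^+ d.+1) / (1 - qv ^+ r.+1)) *: path_sum (m + n) l m n k r.+1 0.
  have shE := @path_sum_shift (m + n) l m n k r.+1 N0 isT kn'; rewrite dE in shE.
  by apply: scale_eq_div shE; rewrite subr_eq0 eq_sym qv_generic.
pose F r := ((1 - qv ^+ d.+1) / (1 - qv ^+ r.+1)) *: path_sum (m + n) l m n k r.+1 0.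
have dN : (d.+1 <= m + n)%N by rewrite -dE (leq_trans (leq_subr _ _)) ?leq_addl.
have -> : LSQ'_sum m n k l = \sum_(r < m + n) F r.
  by rewrite LSQ'_sum_split; apply: eq_bigr => r _; apply: shiftE.
(* [LD_sum] is [path_sum] at shift 0, by conversion. *)
transitivity (\sum_(r < d.+1) F r).
  by apply: eq_bigr => r _; rewrite hf.
(* Square paths may a priori have up to [m + n] touching points, while the expansion stops at
   [n - k]; the terms beyond vanish by [path_sum_touching]. *)
rewrite (big_ord_widen _ F dN) big_mkcond; apply: eq_bigr => r _.
case: ltnP => // dr; rewrite /F path_sum_touching ?scaler0 // dE ltnS //.
Qed.

Theorem theorem6p4
    (H : seq nat -> Sym) (hH : modified_macdonald H)
    (diag : (seq nat -> Qqt) -> {linear Sym -> Sym}) (hdiag : diagonal_in H diag)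
    (E : nat -> nat -> Sym) (hE : is_Enk E) :
  ((forall m n k r : nat, (k < n)%N -> (r <= n - k)%N ->
      is_gf (Delta diag (sym_h m)
               (Theta diag (sym_e k) (nabla diag (E (n - k)%N r))))
            (LD_sum m n r k)) ->
   forall m n k : nat, (k < n)%N ->
      is_gf (Delta diag (sym_h m)
               (Theta diag (sym_e k) (nabla diag (omega (psum (n - k)%N)))))
            (LSQ'_sum m n k))
  /\
  ((forall n k r : nat, (k < n)%N -> (r <= n - k)%N ->
      is_gf (Theta diag (sym_e k) (nabla diag (E (n - k)%N r)))
            (LD_sum 0 n r k)) ->
   forall n k : nat, (k < n)%N ->
      is_gf (Theta diag (sym_e k) (nabla diag (omega (psum (n - k)%N))))
            (LSQ'_sum 0 n k)).
Proof.
have opP k : preserves_lincomb (fun x : Sym => Theta diag (sym_e k) (nabla diag x)).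
  apply: (comp_preserves_lincomb (Theta_preserves_lincomb diag _)).
  exact: linear_preserves_lincomb.
split=> [LD m n k kn l|LD n k kn l].
  apply: (square_of_touching hE (f := fun x => in_vars l (Delta diag (sym_h m)
    (Theta diag (sym_e k) (nabla diag x))))) => // [|r rn]; last exact: LD.
  apply: (comp_preserves_lincomb (pleth_preserves_lincomb _)).
  apply: (@comp_preserves_lincomb Qqt Sym Sym Sym (Delta diag (sym_h m)) _ _ (opP k)).
  exact: linear_preserves_lincomb.
apply: (square_of_touching hE (f := fun x => in_vars l
  (Theta diag (sym_e k) (nabla diag x)))) => // [|r rn]; last exact: LD.
exact: (comp_preserves_lincomb (pleth_preserves_lincomb _) (opP k)).
Qed.
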